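(* Let $0 < \varepsilon \leq 1/2$, $k$ be any positive integer, and $X \subseteq \mathbb{R}^d$ a dataset of $n$ points. There exists an algorithm in the SSAC framework that runs in time $O(n d k^9/\varepsilon^4)$ and with probability at least $\frac{1}{4}$ outputs a center set $C$ such that $\Phi(C, X) \leq (1 + \varepsilon) \cdot \Delta_k(X)$. Moreover, the number of same-cluster queries used by the algorithm is $O(k^9/\varepsilon^4)$.
   Context: $\Phi(C,X)=\sum_{x\in X}\min_{c\in C}\|x-c\|^2$; $\Delta_k(X)=\min_{|C|=k}\Phi(C,X)$ is the optimal $k$-means cost. In the SSAC framework a fixed optimal $k$-means clustering $X_1,\dots,X_k$ of $X$ is given implicitly, and the algorithm may ask same-cluster queries: for $x\neq y\in X$, whether $x,y$ belong to the same $X_i$. *)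

(* Defs.v *)
From HB Require Import structures.
From mathcomp Require Import all_boot all_order all_algebra.
From mathcomp Require Import boolp classical_sets reals.

Set Implicit Arguments.
Unset Strict Implicit.
Unset Printing Implicit Defensive.

Import Order.TTheory GRing.Theory Num.Theory.
Local Open Scope ring_scope.

(** * k-means *)

Section KMeans.
Variables (R : realType) (d : nat).

(* Squared Euclidean distance; the library norm on 'rV_d is the sup norm. *)
Definition sqdist (x c : 'rV[R]_d) : R := \sum_(j < d) (x 0 j - c 0 j) ^+ 2.

(* Center sets are duplicate-free sequences.  The default value of the minimum
   is one of its arguments whenever C is nonempty. *)
Definition mindist (C : seq 'rV[R]_d) (x : 'rV[R]_d) : R :=
  \big[Num.min/sqdist x (head 0 C)]_(c <- C) sqdist x c.

Definition Phi (n : nat) (C : seq 'rV[R]_d) (X : 'I_n -> 'rV[R]_d) : R :=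
  \sum_(i < n) mindist C (X i).

Definition Delta (n k : nat) (X : 'I_n -> 'rV[R]_d) : R :=
  inf [set v : R | exists C : seq 'rV[R]_d,
                     [/\ uniq C, size C = k & v = Phi C X]]%classic.

(* The clustering X_1, ..., X_k is given by its label function f, so that X_l is
   the fiber of f over l.  It is an optimal k-means clustering when it is the
   Voronoi partition (ties broken arbitrarily) of an optimal set of k centers. *)
Definition optimal_clustering (n k : nat) (X : 'I_n -> 'rV[R]_d)
    (f : 'I_n -> 'I_k) : Prop :=
  exists c : 'I_k -> 'rV[R]_d,
    [/\ injective c,
        Phi [seq c l | l : 'I_k] X = Delta k X
      & forall i l, sqdist (X i) (c (f i)) <= sqdist (X i) (c l)].

End KMeans.

(** * SSAC algorithms: programs of a randomized real RAM with a same-cluster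
    oracle

    The memory consists of arrays of natural numbers and arrays of reals, all
    initially zero outside of the input.  A program mentions finitely many
    arrays, by name, and every array is indexed by nat.  The syntax does not
    depend on the reals and only contains natural number constants, so that a
    program is a finite object, independent of the size of the input. *)

Inductive iexp : Type :=
| ICst of nat
| ILoad of nat & iexp            (* array name, index *)
| IAdd of iexp & iexp
| ISub of iexp & iexp            (* truncated *)
| IMul of iexp & iexp.

Inductive rexp : Type :=
| ROfI of iexp
| RLoad of nat & iexp            (* array name, index *)
| RAdd of rexp & rexp
| RSub of rexp & rexp
| RMul of rexp & rexp
| RDiv of rexp & rexp.           (* x / 0 = 0 *)

Inductive bexp : Type :=
| BLeI of iexp & iexp
| BLeR of rexp & rexp
| BNot of bexp
| BAnd of bexp & bexp.

(* In the last four commands the first two arguments are the name and the index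
   of the cell that is written. *)
Inductive cmd : Type :=
| Skip
| Seq of cmd & cmd
| If of bexp & cmd & cmd
| While of bexp & cmd
| IStore of nat & iexp & iexp
| RStore of nat & iexp & rexp
| Flip of nat & iexp & rexp          (* a coin with the given bias *)
| Query of nat & iexp & iexp & iexp. (* same-cluster query on two indices *)

Section Semantics.
Variable R : realType.

(* nqueries counts the queries made so far; programs cannot read it. *)
Record state : Type := State {
  imem : nat -> nat -> nat;
  rmem : nat -> nat -> R;
  nqueries : nat }.

Fixpoint ieval (s : state) (e : iexp) : nat :=
  match e with
  | ICst m => m
  | ILoad a i => imem s a (ieval s i)
  | IAdd e1 e2 => (ieval s e1 + ieval s e2)%N
  | ISub e1 e2 => (ieval s e1 - ieval s e2)%N
  | IMul e1 e2 => (ieval s e1 * ieval s e2)%N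
  end.

Fixpoint reval (s : state) (e : rexp) : R :=
  match e with
  | ROfI i => (ieval s i)%:R
  | RLoad a i => rmem s a (ieval s i)
  | RAdd e1 e2 => reval s e1 + reval s e2
  | RSub e1 e2 => reval s e1 - reval s e2
  | RMul e1 e2 => reval s e1 * reval s e2
  | RDiv e1 e2 => reval s e1 / reval s e2
  end.

Fixpoint beval (s : state) (b : bexp) : bool :=
  match b with
  | BLeI e1 e2 => (ieval s e1 <= ieval s e2)%N
  | BLeR e1 e2 => reval s e1 <= reval s e2
  | BNot b1 => ~~ beval s b1
  | BAnd b1 b2 => beval s b1 && beval s b2
  end.

Definition update (T : Type) (m : nat -> nat -> T) (a i : nat) (v : T) :
    nat -> nat -> T :=
  fun a' i' => if (a' == a) && (i' == i) then v else m a' i'.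

Definition set_int (s : state) (a i v : nat) : state :=
  State (update (imem s) a i v) (rmem s) (nqueries s).

Definition set_real (s : state) (a i : nat) (v : R) : state :=
  State (imem s) (update (rmem s) a i v) (nqueries s).

Definition add_query (s : state) : state :=
  State (imem s) (rmem s) (nqueries s).+1.

Definition clamp01 (p : R) : R := Num.min 1 (Num.max 0 p).

(* The commands that remain to be executed, and the current state. *)
Definition config : Type := (seq cmd * state)%type.

Variant transition : Type :=
| Halt of state
| Step of config
| Toss of R & config & config.   (* probability and target of heads; tails *)

Variable same_cluster : nat -> nat -> bool.

Definition next (cfg : config) : transition :=
  let: (K, s) := cfg in
  match K with
  | [::] => Halt s
  | Skip :: K' => Step (K', s)
  | Seq c1 c2 :: K' => Step (c1 :: c2 :: K', s)
  | If b c1 c2 :: K' => Step ((if beval s b then c1 else c2) :: K', s)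
  | While b c :: K' =>
      Step (if beval s b then c :: While b c :: K' else K', s)
  | IStore a i e :: K' => Step (K', set_int s a (ieval s i) (ieval s e))
  | RStore a i e :: K' => Step (K', set_real s a (ieval s i) (reval s e))
  | Flip a i p :: K' =>
      Toss (clamp01 (reval s p))
        (K', set_int s a (ieval s i) 1) (K', set_int s a (ieval s i) 0)
  | Query a i e1 e2 :: K' =>
      Step (K', set_int (add_query s) a (ieval s i)
                  (same_cluster (ieval s e1) (ieval s e2)))
  end.

(* Running time is the number of transitions.  The expressions of a given
   program have bounded size, so a transition is a bounded number of arithmetic
   operations, comparisons and memory accesses. *)

(* Whatever the outcomes of the coins, the machine halts within t transitions,
   in a state that satisfies Q. *)
Fixpoint always (t : nat) (cfg : config) (Q : state -> Prop) : Prop :=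
  match next cfg, t with
  | Halt s, _ => Q s
  | Step cfg', t'.+1 => always t' cfg' Q
  | Toss _ cfg1 cfg2, t'.+1 => always t' cfg1 Q /\ always t' cfg2 Q
  | _, 0 => False
  end.

(* The probability, over independent coins, that the machine halts within t
   transitions in a state that satisfies E. *)
Fixpoint Pr (t : nat) (cfg : config) (E : state -> Prop) : R :=
  match next cfg, t with
  | Halt s, _ => `[< E s >]%:R
  | Step cfg', t'.+1 => Pr t' cfg' E
  | Toss p cfg1 cfg2, t'.+1 => p * Pr t' cfg1 E + (1 - p) * Pr t' cfg2 E
  | _, 0 => 0
  end.

End Semantics.

(** * Input, oracle and output conventions *)

(* Queries are about two distinct points of X; any other query is answered
   negatively, which reveals nothing about the clustering. *)
Definition oracle (n k : nat) (f : 'I_n -> 'I_k) (i j : nat) : bool :=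
  (i != j) &&
  match insub i : option 'I_n, insub j : option 'I_n with
  | Some i', Some j' => f i' == f j'
  | _, _ => false
  end.

Section InputOutput.
Variables (R : realType) (n d k : nat).

(* Integer array 0 starts with n, d, k.  Real array 0 contains the coordinates
   of the points of X in row-major order and real array 2 starts with eps. *)
Definition init_state (eps : R) (X : 'I_n -> 'rV[R]_d) : state R :=
  State
    (fun a i => if a == 0 then nth 0 [:: n; d; k] i else 0)%N
    (fun a i =>
       if a == 0%N then
         nth 0 (flatten [seq [seq X p 0 j | j : 'I_d] | p : 'I_n]) i
       else if (a == 2)%N && (i == 0)%N then eps else 0)
    0.

(* The k centers are read from real array 1, in row-major order. *)
Definition output (s : state R) : seq 'rV[R]_d :=
  [seq \row_(j < d) rmem s 1 (l * d + j) | l : 'I_k].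

End InputOutput.

(* Main.v *)
Require Import Defs.
From mathcomp Require Import all_boot all_order all_algebra.
From mathcomp Require Import boolp classical_sets reals.
From mathcomp Require Import ring lra zify.

Set Implicit Arguments.
Unset Strict Implicit.
Unset Printing Implicit Defensive.

Import Order.TTheory GRing.Theory Num.Theory.
Local Open Scope ring_scope.

(** Let [c] be optimal centers, with clusters X_1, ..., X_k and cost OPT.

    Seeding.  Starting from one point, draw 8k anchors by D^2-sampling.  As long
    as the cost of the anchors exceeds 64 OPT, at least half of it lies in
    clusters whose own cost exceeds 32 times the optimum, and a D^2-sample in
    such a cluster repairs it with probability 1/2.  Hence each round lowers the
    expected number of these clusters by 1/4, and after 8k rounds the anchors
    cost at most 64 OPT with probability 1/2.

    Recovery.  Draw m = O(k^3 / eps^3) points with probability q(x) proportional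
    to D^2(x) / (total cost) + 1 / |cell of x|, where the cells are those of the
    anchors.  Classify them by same-cluster queries against one representative
    per cluster and output the means weighted by 1 / q.  If q(x) |X_j| >= zeta on
    all of X_j, Chebyshev's inequality shows that this mean is close to the mean
    of X_j.  Otherwise some x in X_j is very close to an anchor whose cell is much
    larger than X_j; every center set that serves this cell well has a center
    near the anchor, and so does [c], so that c_j, which is the closest center to
    x, is near it too.  X_j is then served well whatever has been sampled from
    it. *)

(** The program knows neither the optimal cost nor the sizes |X_j|. The estimated mean is therefore
    a ratio of two weighted sums, in which the normalization of q cancels, and the denominator has
    to concentrate as well as the numerator. Whether a cluster is large enough for this depends on
    the anchors only and is settled before any sample is drawn, so that clusters too small to be hit
    never enter the probabilistic estimate. Their error is bounded in terms of the cost of the very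
    center set under judgement. This is circular, but that cost reappears with a factor of at most
    eps/600 and is absorbed.

    Constants: k clusters may each lose z times a constant cost, amplified by about 1/eps, so z is
    of order eps^2/k. The weights sum to at most 8k+2, so zeta = z/(10k). Chebyshev needs m of order
    k/(zeta eps), that is k^3/eps^3. Seeding and recovery succeed with probability 1/2 each, which
    gives 1/4.

    No probability space is built: each state of the program carries the success probability still
    owed, and the expectations over the remaining draws serve as loop invariants. *)

Section Geometry.
Variables (R : realType) (d : nat).
Implicit Types (x y z c : 'rV[R]_d) (C : seq 'rV[R]_d).

Lemma sqdist_ge0 x y : 0 <= sqdist x y.
Proof. by apply: sumr_ge0 => j _; apply: sqr_ge0. Qed.

Lemma sqdistC x y : sqdist x y = sqdist y x.
Proof. by apply: eq_bigr => j _; ring. Qed.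

Lemma sqdistxx x : sqdist x x = 0.
Proof. by rewrite /sqdist big1 // => j _; rewrite subrr expr0n. Qed.

Lemma sqdist_eq0 x y : sqdist x y = 0 -> x = y.
Proof.
move=> /eqP; rewrite psumr_eq0 => [/allP h|j _]; last exact: sqr_ge0.
apply/rowP => j; apply/eqP; rewrite -subr_eq0 -sqrf_eq0.
by apply: h; rewrite mem_index_enum.
Qed.

Lemma sqdist_young (e : R) x y z : 0 < e ->
  sqdist x z <= (1 + e) * sqdist x y + (1 + e^-1) * sqdist y z.
Proof.
move=> e0; rewrite /sqdist !mulr_sumr -big_split /=; apply: ler_sum => j _.
set a := x 0 j - y 0 j; set b := y 0 j - z 0 j.
have -> : x 0 j - z 0 j = a + b by rewrite /a /b; ring.
suff : 0 <= e * (a - e^-1 * b) ^+ 2.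
  have -> : e * (a - e^-1 * b) ^+ 2 = e * a ^+ 2 - 2 * a * b + e^-1 * b ^+ 2.
    by field; rewrite gt_eqF.
  by lra.
by rewrite mulr_ge0 ?sqr_ge0 // ltW.
Qed.

Lemma sqdist_tri2 x y z : sqdist x z <= 2 * sqdist x y + 2 * sqdist y z.
Proof. by have := sqdist_young x y z (@ltr01 R); rewrite invr1. Qed.

Lemma sqdist_tri3 x y z c :
  sqdist x c <= 3 * (sqdist x y + sqdist y z + sqdist z c).
Proof.
rewrite /sqdist -!big_split /= mulr_sumr; apply: ler_sum => j _ /=.
set p := x 0 j; set q := y 0 j; set r := z 0 j; set s := c 0 j.
have h1 := sqr_ge0 ((p - q) - (q - r)); have h2 := sqr_ge0 ((p - q) - (r - s)).
by have h3 := sqr_ge0 ((q - r) - (r - s)); nra.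
Qed.

Lemma mindist_le C x c : c \in C -> mindist C x <= sqdist x c.
Proof.
rewrite /mindist; elim: C (sqdist x _) => // a C IH v.
rewrite inE big_cons => /orP[/eqP ->|/IH h]; first by rewrite ge_min lexx.
by rewrite ge_min h orbT.
Qed.

Lemma mindist_attained C x : C != [::] ->
  exists2 c, c \in C & mindist C x = sqdist x c.
Proof.
case: C => // a C _; rewrite /mindist big_cons /=.
have [c cC ->] : exists2 c, c \in a :: C &
    \big[Num.min/sqdist x a]_(e <- C) sqdist x e = sqdist x c.
  elim: C => [|b C [e eC IH]]; first by exists a; rewrite ?inE ?eqxx ?big_nil.
  rewrite big_cons IH; have [_|_] := leP (sqdist x b) (sqdist x e).
    by exists b; rewrite ?inE ?eqxx ?orbT.
  by exists e => //; move: eC; rewrite !inE => /orP[->|->]; rewrite ?orbT.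
by have [_|_] := leP (sqdist x a) (sqdist x c); [exists a|exists c]; rewrite ?mem_head.
Qed.

Lemma mindist_ge0 C x : C != [::] -> 0 <= mindist C x.
Proof. by move=> /(mindist_attained x)[c _ ->]; apply: sqdist_ge0. Qed.

End Geometry.

(** * Optimal clusters, cells of the anchors, and the deterministic cost bound *)

Section Clusters.
Variables (R : realType) (d n k : nat).
Variables (X : 'I_n -> 'rV[R]_d) (f : 'I_n -> 'I_k) (c : 'I_k -> 'rV[R]_d).

Definition cost : R := \sum_i sqdist (X i) (c (f i)).
Definition costj (j : 'I_k) : R := \sum_(i | f i == j) sqdist (X i) (c j).
Definition csize (j : 'I_k) : R := \sum_(i | f i == j) 1.
Definition mean (j : 'I_k) : 'rV[R]_d :=
  \row_a ((\sum_(i | f i == j) X i 0 a) / csize j).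

Lemma sum_fibers (F : 'I_n -> R) : \sum_i F i = \sum_j \sum_(i | f i == j) F i.
Proof. by rewrite (partition_big f predT). Qed.

Lemma costE : cost = \sum_j costj j.
Proof.
by rewrite /cost sum_fibers; apply: eq_bigr => j _; apply: eq_bigr => i /eqP ->.
Qed.

Lemma costj_ge0 j : 0 <= costj j.
Proof. by apply: sumr_ge0 => i _; apply: sqdist_ge0. Qed.

Lemma cost_ge0 : 0 <= cost.
Proof. by apply: sumr_ge0 => i _; apply: sqdist_ge0. Qed.

Lemma costj_le j : costj j <= cost.
Proof.
by rewrite costE (bigD1 j) //= lerDl; apply: sumr_ge0 => i _; apply: costj_ge0.
Qed.

Lemma csize_ge0 j : 0 <= csize j.
Proof. by apply: sumr_ge0. Qed.

Lemma csize_gt0 x : 0 < csize (f x).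
Proof. by rewrite /csize (bigD1 x) //= ltr_pwDl // sumr_ge0. Qed.

(** Parallel axis identity: the cross terms vanish because deviations from the mean sum to zero. *)
Lemma cost_mean j (y : 'rV[R]_d) : 0 < csize j ->
  \sum_(i | f i == j) sqdist (X i) y =
  \sum_(i | f i == j) sqdist (X i) (mean j) + csize j * sqdist (mean j) y.
Proof.
move=> j0; rewrite /sqdist exchange_big /=.
rewrite [in X in _ = X + _]exchange_big /= mulr_sumr -big_split /=.
apply: eq_bigr => a _; rewrite !mxE.
set N := csize j; set s := \sum_(i | f i == j) X i 0 a; set m := s / N.
have sN : s = m * N by rewrite /m divfK // gt_eqF.
transitivity (\sum_(i | f i == j) ((X i 0 a - m) ^+ 2
    + (2 * (m - y 0 a) * X i 0 a + (y 0 a ^+ 2 - m ^+ 2) * 1))).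
  by apply: eq_bigr => i _; ring.
rewrite !big_split /= -!mulr_sumr -/s -/(csize j) -/N; clearbody m; rewrite sN; ring.
Qed.

Lemma cost_mean_le j : 0 < csize j ->
  \sum_(i | f i == j) sqdist (X i) (mean j) <= costj j.
Proof.
move=> j0; rewrite /costj (cost_mean (c j) j0) lerDl.
by rewrite mulr_ge0 ?sqdist_ge0 // ltW.
Qed.

Hypothesis voronoi : forall i l, sqdist (X i) (c (f i)) <= sqdist (X i) (c l).

Lemma Phi_centers : Phi [seq c l | l : 'I_k] X = cost.
Proof.
apply: eq_bigr => i _; apply/eqP; rewrite eq_le mindist_le /=; last first.
  by apply/mapP; exists (f i); rewrite ?mem_enum.
have [|y /mapP[l _ ->] ->] := @mindist_attained R d [seq c l | l : 'I_k] (X i).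
  by apply/eqP => /(congr1 size); rewrite size_map size_enum_ord; case: (k) (f i) => // -[].
exact: voronoi.
Qed.

Variable b : 'I_n -> 'I_n.

Definition adist (x : 'I_n) : R := sqdist (X x) (X (b x)).
Definition acost : R := \sum_x adist x.
Definition cell (p : 'I_n) : R := \sum_(x | b x == p) 1.

Lemma adist_ge0 x : 0 <= adist x. Proof. exact: sqdist_ge0. Qed.
Lemma acost_ge0 : 0 <= acost. Proof. by apply: sumr_ge0 => x _; apply: adist_ge0. Qed.

Lemma cell_gt0 x : 0 < cell (b x).
Proof. by rewrite /cell (bigD1 x) //= ltr_pwDl // sumr_ge0. Qed.

(** Averaging over the cell of [b x]: by the triangle inequality through [X y], the distances from
    the anchor to the [g y] sum to at most the right-hand side, so some [g y] is at most average. It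
    is applied once to the optimal centers and once to the nearest centers in [C]. *)
Lemma anchor_near (g : 'I_n -> 'rV[R]_d) (x : 'I_n) :
  exists y, cell (b x) * sqdist (X (b x)) (g y) <=
    2 * (acost + \sum_i sqdist (X i) (g i)).
Proof.
apply/existsP; apply: contraT; rewrite negb_exists => /forallP h.
set B := 2 * _ in h.
have : cell (b x) * B < \sum_(y | b y == b x) cell (b x) * sqdist (X (b x)) (g y).
  have -> : cell (b x) * B = \sum_(y | b y == b x) B.
    by rewrite /cell mulr_suml; apply: eq_bigr => y _; rewrite mul1r.
  rewrite (bigD1 x) //= [ltRHS](bigD1 x) //=; apply: ltr_leD; first by rewrite ltNge h.
  by apply: ler_sum => y _; rewrite ltW // ltNge h.
rewrite -mulr_sumr ltr_pM2l ?cell_gt0 // ltNge => /negP[].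
apply: le_trans (_ : \sum_(y | b y == b x) (2 * adist y + 2 * sqdist (X y) (g y)) <= _).
  apply: ler_sum => y /eqP <-; apply: le_trans (sqdist_tri2 _ (X y) _) _.
  by rewrite /adist (sqdistC (X (b y))).
rewrite /B mulrDr /acost !mulr_sumr -big_split /= [leRHS](bigID (fun y => b y == b x)) /=.
by rewrite lerDl sumr_ge0 // => y _; rewrite addr_ge0 // mulr_ge0 ?sqdist_ge0.
Qed.

Lemma light_near (z : R) (C : seq 'rV[R]_d) (x : 'I_n) (j := f x) :
  0 < z -> C != [::] -> adist x * csize j <= z * acost ->
  csize j <= z * cell (b x) ->
  exists2 y, y \in C &
    csize j * sqdist (c j) y <= 27 * z * (acost + cost + Phi C X).
Proof.
move=> z0 C0 hD hn; set N := csize j in hD hn *.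
have N0 : 0 <= N := csize_ge0 j.
(* A cluster is at most [z] times as large as the cell, so a bound weighted by the cell size becomes
   one weighted by |X_j|, smaller by the factor [z]. *)
have near (t S : R) : 0 <= t -> cell (b x) * t <= S -> N * t <= z * S.
  move=> t0 h; apply: le_trans (_ : z * (cell (b x) * t) <= _).
    by rewrite mulrA ler_wpM2r.
  by rewrite ler_pM2l.
have [y1] := anchor_near (fun i => c (f i)) x.
move=> /(near _ _ (sqdist_ge0 _ _)); rewrite -/cost => h1.
have [g gC] : exists2 g : 'I_n -> 'rV[R]_d, forall i, g i \in C &
    forall i, mindist C (X i) = sqdist (X i) (g i).
  have /choice[g hg] : forall i, exists y, y \in C /\ mindist C (X i) = sqdist (X i) y.
    by move=> i; have [y yC ->] := mindist_attained (X i) C0; exists y.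
  by exists g => i; case: (hg i).
move=> gE; have [y2] := anchor_near g x.
move=> /(near _ _ (sqdist_ge0 _ _)).
have <- : Phi C X = \sum_i sqdist (X i) (g i) by apply: eq_bigr.
move=> h2; exists (g y2) => //.
(* The Voronoi property enters here: [c j] is at least as close to [x] as the optimal center that
   was found near the anchor. *)
have h3 := le_trans (voronoi x (f y1)) (sqdist_tri2 (X x) (X (b x)) (c (f y1))).
have h4 := sqdist_tri3 (c j) (X x) (X (b x)) (g y2).
rewrite -/(adist x) -/j in h3; rewrite -/(adist x) (sqdistC (c j) (X x)) in h4.
set p := sqdist (X x) (c j) in h3 h4; set q := sqdist (X (b x)) (c _) in h1 h3.
set r := sqdist (X (b x)) (g y2) in h2 h4.
have h5 : N * p <= 2 * (adist x * N) + 2 * (N * q).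
  by apply: le_trans (ler_wpM2l N0 h3) _; lra.
apply: le_trans (ler_wpM2l N0 h4) _.
(* In units of [z * acost], the three summands contribute at most 6, 1 and 2; the outer 3 makes 27.
   The multiples of [cost] and [Phi C X] are smaller. *)
have -> : N * (3 * (p + adist x + r)) = 3 * (N * p + adist x * N + N * r) by ring.
have c0 := mulr_ge0 (ltW z0) cost_ge0; have a0 := mulr_ge0 (ltW z0) acost_ge0.
have P0 : 0 <= z * Phi C X.
  by rewrite mulr_ge0 ?sumr_ge0 ?(ltW z0) // => i _; apply: mindist_ge0.
by lra.
Qed.

Lemma serve_by (C : seq 'rV[R]_d) (j : 'I_k) (y : 'rV[R]_d) : y \in C ->
  \sum_(i | f i == j) mindist C (X i) <= \sum_(i | f i == j) sqdist (X i) y.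
Proof. by move=> yC; apply: ler_sum => i _; apply: mindist_le. Qed.

(** Light clusters pay a Young inequality plus an error proportional to [F], the others pay [e].
    Since [F] contains [Phi C X], the summed bound has the unknown on both sides and is solved for
    it at the end. *)
Lemma approx_cost (eps z : R) (C : seq 'rV[R]_d) (e : 'I_k -> R) :
  0 < eps <= 2^-1 -> C != [::] -> 0 < z -> 300 * 300 * k%:R * z <= eps ^+ 2 ->
  acost <= 64 * cost -> (forall j, 0 <= e j) -> \sum_j e j <= eps / 4 * cost ->
  (forall x, (exists y, [/\ f y = f x, adist y * csize (f y) <= z * acost
       & csize (f y) <= z * cell (b y)])
    \/ (exists2 y, y \in C & csize (f x) * sqdist (mean (f x)) y <= e (f x))) ->
  Phi C X <= (1 + eps) * cost.
Proof.
move=> /andP[e0 e1] C0 z0 hz ha e_ge0 he H.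
set F := acost + cost + Phi C X.
have F0 : 0 <= F.
  rewrite !addr_ge0 ?acost_ge0 ?cost_ge0 //.
  by apply: sumr_ge0 => i _; apply: mindist_ge0.
set u := eps / 4; have u0 : 0 < u by rewrite /u; lra.
have uV : 0 < u^-1 by rewrite invr_gt0.
have G0 : 0 <= (1 + u^-1) * (27 * z * F).
  by rewrite mulr_ge0 ?addr_ge0 ?(ltW uV) // !mulr_ge0 // ltW.
have hj j : \sum_(i | f i == j) mindist C (X i) <=
    (1 + u) * costj j + e j + (1 + u^-1) * (27 * z * F).
  have [x /eqP xj|j0] := pickP (fun x => f x == j); last first.
    rewrite big_pred0 // !addr_ge0 // mulr_ge0 ?costj_ge0 //; lra.
  have j0 : 0 < csize j by rewrite -xj csize_gt0.
  have := H x; rewrite xj => -[[x' [xj' h1 h2]]|[y yC hy]].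
    have [y yC hy] := light_near z0 C0 h1 h2.
    rewrite xj' -/F in hy; apply: le_trans (serve_by j yC) _.
    apply: le_trans (_ : \sum_(i | f i == j) ((1 + u) * sqdist (X i) (c j)
       + (1 + u^-1) * sqdist (c j) y * 1) <= _).
      by apply: ler_sum => i _; rewrite mulr1; apply: sqdist_young.
    rewrite big_split /= -!mulr_sumr -/(costj j) -/(csize j).
    have -> : (1 + u^-1) * sqdist (c j) y * csize j =
      (1 + u^-1) * (csize j * sqdist (c j) y) by ring.
    rewrite -addrA lerD2l -[leLHS]add0r lerD // ler_wpM2l //; lra.
  apply: le_trans (serve_by j yC) _; rewrite (cost_mean y j0).
  have := cost_mean_le j0; have := costj_ge0 j => h0 h1.
  have : 0 <= u * costj j by rewrite mulr_ge0 // ltW.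
  lra.
have := ler_sum (index_enum 'I_k) (fun j (_ : xpredT j) => hj j).
rewrite -sum_fibers -/(Phi C X) !big_split /= -mulr_sumr -costE sumr_const card_ord.
rewrite -[_ *+ k]mulr_natr => h.
(* With [u = eps / 4], [1 + 1/u] times [eps] is [eps + 4], at most 9/2, and 27 * (9/2) / 300^2 is
   below 1/600. *)
have key : (1 + u^-1) * (27 * z * F) * k%:R <= eps / 600 * F.
  have u1 : (1 + u^-1) * eps <= 9 / 2.
    have -> : (1 + u^-1) * eps = eps + 4 by rewrite /u; field; rewrite gt_eqF.
    lra.
  have -> : (1 + u^-1) * (27 * z * F) * k%:R = 27 * F * ((1 + u^-1) * (z * k%:R)) by ring.
  have -> : eps / 600 * F = 27 * F * (eps / (600 * 27)) by field.
  apply: ler_wpM2l; first lra.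
  have -> : (1 + u^-1) * (z * k%:R) = (1 + u^-1) * eps * (z * k%:R / eps).
    by rewrite -[RHS]mulrA [eps * _]mulrC divfK // gt_eqF.
  have hz' : z * k%:R / eps <= eps / (300 * 300) by rewrite ler_pdivrMr //; lra.
  apply: le_trans (ler_pM _ _ u1 hz') _; first by rewrite mulr_ge0 ?(ltW e0) ?addr_ge0 ?(ltW uV).
    by rewrite divr_ge0 ?(ltW e0) // mulr_ge0 // ltW.
  lra.
have {key} h := le_trans h (lerD (lexx _) key).
have hF : F <= 65 * cost + Phi C X by rewrite /F; lra.
(* 61/100 exceeds 1/4 + 1/4 + 65/600: the Young loss, the total of [e], and the share of [65 * cost]
   in [F]. *)
have P0 : Phi C X <= (1 + 61 / 100 * eps) * cost + eps / 600 * Phi C X.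
  have : eps / 600 * F <= eps / 600 * (65 * cost + Phi C X) by rewrite ler_wpM2l //; lra.
  have := mulr_ge0 (ltW e0) cost_ge0; rewrite /u in he h *; lra.
have h1 : (1 - eps / 600) * Phi C X <= (1 + 61 / 100 * eps) * cost by lra.
have h2 : (1 + 61 / 100 * eps) * cost <= (1 - eps / 600) * ((1 + eps) * cost).
  by rewrite mulrA; apply: ler_wpM2r; [exact: cost_ge0|nra].
by have := le_trans h1 h2; rewrite ler_pM2l //; lra.
Qed.

End Clusters.

(** * Independent samples *)

Section Iterate.
Variables (R : realType) (I : finType) (q : I -> R).

(** Expectation of [h] over [m] independent draws from [q] prepended to [xs]. With the draws already
    made as an argument, it is the conditional expectation in the middle of the sampling loop. *)
Fixpoint iterE (m : nat) (h : seq I -> R) (xs : seq I) : R :=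
  if m is m'.+1 then \sum_a q a * iterE m' h (a :: xs) else h xs.

Hypothesis q_ge0 : forall a, 0 <= q a.
Hypothesis q_sum : \sum_a q a = 1.

Lemma le_iterE m h1 h2 xs :
  (forall ys, size ys = (m + size xs)%N -> h1 ys <= h2 ys) ->
  iterE m h1 xs <= iterE m h2 xs.
Proof.
elim: m xs => [|m IH] xs h /=; first exact: h.
apply: ler_sum => a _; apply: ler_wpM2l => //; apply: IH => ys hy.
by apply: h; rewrite hy /= addnS.
Qed.

Lemma iterE_cst m v xs : iterE m (fun=> v) xs = v.
Proof.
elim: m xs => //= m IH xs.
by under eq_bigr => a _ do rewrite IH; rewrite -mulr_suml q_sum mul1r.
Qed.

Lemma iterED m h1 h2 xs :
  iterE m (fun ys => h1 ys + h2 ys) xs = iterE m h1 xs + iterE m h2 xs.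
Proof.
elim: m xs => //= m IH xs; rewrite -big_split /=.
by apply: eq_bigr => a _; rewrite IH mulrDr.
Qed.

Lemma iterEZ m v h xs : iterE m (fun ys => v * h ys) xs = v * iterE m h xs.
Proof.
elim: m xs => //= m IH xs; rewrite mulr_sumr.
by apply: eq_bigr => a _; rewrite IH mulrCA.
Qed.

Lemma iterE_sum (J : Type) (r : seq J) (P : pred J) m (h : J -> seq I -> R) xs :
  iterE m (fun ys => \sum_(j <- r | P j) h j ys) xs =
  \sum_(j <- r | P j) iterE m (h j) xs.
Proof.
elim: m xs => //= m IH xs; rewrite exchange_big /=.
by apply: eq_bigr => a _; rewrite IH mulr_sumr.
Qed.

Lemma iterE_sqr_sum m (h : I -> R) xs : \sum_a q a * h a = 0 ->
  iterE m (fun ys => (\sum_(y <- ys) h y) ^+ 2) xs =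
  (\sum_(x <- xs) h x) ^+ 2 + m%:R * \sum_a q a * h a ^+ 2.
Proof.
move=> h0; elim: m xs => [|m IH] xs /=; first by rewrite mul0r addr0.
under eq_bigr => a _ do rewrite IH big_cons.
set A := \sum_(x <- xs) h x; set V := \sum_a q a * h a ^+ 2.
transitivity (\sum_a (q a * h a ^+ 2 + (2 * A * (q a * h a)
   + (A ^+ 2 + m%:R * V) * q a))).
  by apply: eq_bigr => a _; ring.
rewrite !big_split /= -!mulr_sumr h0 q_sum -/V -natr1; ring.
Qed.

Lemma variance_le (g : I -> R) (G := \sum_a q a * g a) :
  \sum_a q a * (g a - G) ^+ 2 <= \sum_a q a * g a ^+ 2.
Proof.
have -> : \sum_a q a * (g a - G) ^+ 2 = \sum_a q a * g a ^+ 2 - G ^+ 2.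
  transitivity (\sum_a (q a * g a ^+ 2 + (- 2 * G * (q a * g a) + G ^+ 2 * q a))).
    by apply: eq_bigr => a _; ring.
  by rewrite !big_split /= -!mulr_sumr q_sum -/G; ring.
by rewrite gerBl sqr_ge0.
Qed.

Lemma centered (g : I -> R) (G := \sum_a q a * g a) : \sum_a q a * (g a - G) = 0.
Proof.
under eq_bigr => a _ do rewrite mulrBr.
by rewrite sumrB -mulr_suml q_sum mul1r subrr.
Qed.

End Iterate.

(** * Recovery of the centers by importance sampling *)

Section Recovery.
Variables (R : realType) (d n k : nat).
Variables (X : 'I_n -> 'rV[R]_d) (f : 'I_n -> 'I_k) (c : 'I_k -> 'rV[R]_d).
Variable b : 'I_n -> 'I_n.
Variable i0 : 'I_n.

Local Notation D := (adist X b).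
Local Notation N := (csize R f).
Local Notation mu := (mean X f).

Definition aw (x : 'I_n) : R := D x / acost X b + (cell R b (b x))^-1.
Definition awS : R := \sum_x aw x.
Definition aq (x : 'I_n) : R := aw x / awS.

(** Self-normalized importance sampling estimate of the mean of a cluster. Only the unnormalized
    weights [aw] occur, since the factor [awS] is common to both sums. *)
Definition wmean (xs : seq 'I_n) (j : 'I_k) : 'rV[R]_d :=
  \row_a ((\sum_(x <- xs | f x == j) X x 0 a / aw x) /
          (\sum_(x <- xs | f x == j) (aw x)^-1)).

Lemma aw_gt0 x : 0 < aw x.
Proof.
by rewrite ltr_wpDl ?invr_gt0 ?cell_gt0 // divr_ge0 ?adist_ge0 ?acost_ge0.
Qed.

Lemma awS_gt0 : 0 < awS.
Proof.
rewrite /awS (bigD1 i0) //= ltr_pwDl ?aw_gt0 // sumr_ge0 // => x _.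
by rewrite ltW ?aw_gt0.
Qed.

Lemma aq_gt0 x : 0 < aq x. Proof. by rewrite divr_gt0 ?aw_gt0 ?awS_gt0. Qed.

Lemma aq_sum : \sum_x aq x = 1.
Proof. by rewrite -mulr_suml divff // gt_eqF // awS_gt0. Qed.

(** The cell terms contribute exactly 1 for each nonempty cell, and the distance terms together at
    most 1, whence the successor. *)
Lemma awS_le (cs : seq 'I_n) : (forall x, b x \in cs) -> awS <= (size cs).+1%:R.
Proof.
move=> hb; rewrite /awS big_split /= -natr1 addrC lerD //.
  rewrite (partition_big b (mem cs)) /=; last by move=> x _; apply: hb.
  apply: le_trans (_ : \sum_(p in cs) 1 <= _); last first.
    by rewrite sumr_const ler_nat card_size.
  apply: ler_sum => p _.
  have -> : \sum_(x | b x == p) (cell R b (b x))^-1 = cell R b p * (cell R b p)^-1.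
    by rewrite {2}/cell mulr_suml; apply: eq_bigr => x /eqP ->; rewrite mul1r.
  by have [->|h] := eqVneq (cell R b p) 0; rewrite ?mul0r // divff.
rewrite -mulr_suml; have [h|h] := eqVneq (acost X b) 0.
  by rewrite h invr0 mulr0.
by rewrite divff.
Qed.

Variables (eps z zeta : R) (m : nat).
Hypothesis voronoi : forall i l, sqdist (X i) (c (f i)) <= sqdist (X i) (c l).
Hypothesis eps_bnd : 0 < eps <= 2^-1.
Hypothesis z_gt0 : 0 < z.
Hypothesis z_le : 300 * 300 * k%:R * z <= eps ^+ 2.
Hypothesis zeta_gt0 : 0 < zeta.
Hypothesis zeta_le : zeta * awS <= z.
Hypothesis m_ge : 40 * k%:R <= m%:R * zeta * eps.
Hypothesis k_gt0 : (0 < k)%N.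
Hypothesis acost_le : acost X b <= 64 * cost X f c.

Definition heavy (j : 'I_k) := (0 < N j) && [forall (x | f x == j), zeta <= aq x * N j].

Definition hit (j : 'I_k) (x : 'I_n) : R := (f x == j)%:R / aq x.
Definition dev (j : 'I_k) (a : 'I_d) (x : 'I_n) : R := hit j x * (X x 0 a - mu j 0 a).

(** A point violating the heaviness condition has [aw y * |X_j| < z]. Each of the two nonnegative
    summands of [aw y] obeys this bound by itself, and these are the two conditions of
    [light_near]. *)
Lemma not_heavy x : ~~ heavy (f x) -> exists y, [/\ f y = f x,
  D y * N (f y) <= z * acost X b & N (f y) <= z * cell R b (b y)].
Proof.
rewrite /heavy csize_gt0 /= negb_forall => /existsP[y]; rewrite negb_imply -ltNge.
move=> /andP[/eqP fy h]; exists y; rewrite fy.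
have {}h : aw y * N (f x) < z.
  apply: lt_le_trans zeta_le; rewrite -ltr_pdivrMr ?awS_gt0 //.
  by rewrite mulrAC.
split=> //.
  (* If the anchors cost nothing, the distance term of [aw] is a division by zero and carries no
     information, but then all distances vanish. *)
  have [a0|a0] := eqVneq (acost X b) 0.
    have : D y <= 0 by rewrite -a0 /acost (bigD1 y) //= lerDl sumr_ge0 // => *; apply: adist_ge0.
    rewrite a0 mulr0 => h0; rewrite mulr_le0_ge0 // csize_ge0 //.
  have {a0} a0 : 0 < acost X b by rewrite lt_def a0 acost_ge0.
  rewrite -ler_pdivrMr // mulrAC; apply: le_trans (ltW h); rewrite ler_wpM2r ?csize_ge0 //.
  by rewrite lerDl invr_ge0 ltW ?cell_gt0.
rewrite -ler_pdivrMr ?cell_gt0 // mulrC; apply: le_trans (ltW h).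
by rewrite ler_wpM2r ?csize_ge0 // lerDr divr_ge0 ?adist_ge0 ?acost_ge0.
Qed.

Lemma hitE (F : 'I_n -> R) j :
  \sum_x aq x * (hit j x * F x) = \sum_(x | f x == j) F x.
Proof.
rewrite [RHS]big_mkcond /=; apply: eq_bigr => x _; rewrite /hit.
by case: (f x == j); rewrite ?mul0r ?mulr0 // mul1r mulrA divff ?mul1r // gt_eqF ?aq_gt0.
Qed.

Lemma hit_sum j : \sum_x aq x * hit j x = N j.
Proof. by rewrite /csize; have <- := hitE (fun=> 1) j; apply: eq_bigr => x _; rewrite mulr1. Qed.

(** This is where heaviness pays: on the cluster the importance ratio [1 / aq] is at most
    [N j / zeta], so one of the two factors [hit] is replaced by that bound and the other one is
    unbiased. *)
Lemma hit_sqr_le (F : 'I_n -> R) j : heavy j -> (forall x, 0 <= F x) ->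
  \sum_x aq x * (hit j x ^+ 2 * F x) <= N j / zeta * \sum_(x | f x == j) F x.
Proof.
move=> /andP[j0 /forallP hj] F0.
have -> : \sum_x aq x * (hit j x ^+ 2 * F x) = \sum_x aq x * (hit j x * (hit j x * F x)).
  by apply: eq_bigr => x _; ring.
rewrite hitE mulr_sumr; apply: ler_sum => x fx; rewrite ler_wpM2r // /hit fx.
have := hj x; rewrite fx /= => h.
by rewrite ler_pdivrMr ?aq_gt0 // mulrAC ler_pdivlMr // mul1r mulrC.
Qed.

Lemma sum_csize j (v : R) : \sum_(x | f x == j) v = N j * v.
Proof. by rewrite /csize mulr_suml; apply: eq_bigr => x _; rewrite mul1r. Qed.

Lemma dev_sum j a : 0 < N j -> \sum_x aq x * dev j a x = 0.
Proof.
move=> j0; rewrite (hitE (fun x => X x 0 a - mu j 0 a)) sumrB sum_csize mxE.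
by rewrite mulrC divfK ?subrr // gt_eqF.
Qed.

(** Normalized squared errors, added up for a single application of Markov's inequality. If [bad] is
    below 1, the first terms force every heavy denominator above half its expectation, and the
    second terms keep the sum of all squared errors of the means within [eps / 4] of the cost. That
    budget is shared by the clusters, which saves a union bound. *)
Definition bad (xs : seq 'I_n) : R := \sum_(j | heavy j)
  (4 / (m%:R ^+ 2 * N j ^+ 2) * (\sum_(x <- xs) (hit j x - N j)) ^+ 2
   + 16 / (eps * cost X f c * N j * m%:R ^+ 2) *
     \sum_a (\sum_(x <- xs) dev j a x) ^+ 2).

Let m_gt0 : 0 < m%:R :> R.
Proof.
have k0 : 0 < k%:R :> R by rewrite ltr0n.
have /andP[e0 _] := eps_bnd.
have : 0 < m%:R * zeta * eps by apply: lt_le_trans m_ge; rewrite mulr_gt0.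
by rewrite pmulr_lgt0 // pmulr_lgt0.
Qed.

Lemma E_bad : iterE aq m bad [::] <= 2^-1.
Proof.
have /andP[e0 e1] := eps_bnd.
have k0 : 0 < k%:R :> R by rewrite ltr0n.
have k1 : 1 <= k%:R :> R by rewrite ler1n.
have S1 := aq_sum.
pose w := (m%:R * zeta)^-1.
have w0 : 0 < w by rewrite invr_gt0 mulr_gt0.
have hw : 40 * k%:R * w <= eps.
  by rewrite ler_pdivrMr ?mulr_gt0 // (le_trans m_ge) // mulrC.
have bnd j : heavy j -> iterE aq m (fun xs =>
    4 / (m%:R ^+ 2 * N j ^+ 2) * (\sum_(x <- xs) (hit j x - N j)) ^+ 2
   + 16 / (eps * cost X f c * N j * m%:R ^+ 2) *
     \sum_a (\sum_(x <- xs) dev j a x) ^+ 2) [::] <=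
   4 * w + 16 / (eps * cost X f c) * w * costj X f c j.
  move=> hj; have /andP[j0 _] := hj.
  rewrite iterED !iterEZ iterE_sum; apply: lerD.
    rewrite iterE_sqr_sum //; last by have := centered S1 (hit j); rewrite hit_sum.
    rewrite big_nil expr0n /= add0r.
    apply: le_trans (_ : 4 / (m%:R ^+ 2 * N j ^+ 2) * (m%:R * (N j / zeta * N j)) <= _).
      apply: ler_wpM2l; first by rewrite divr_ge0 // mulr_ge0 // sqr_ge0.
      apply: ler_wpM2l => //.
      have := variance_le S1 (hit j); rewrite hit_sum => /le_trans; apply.
      have := hit_sqr_le hj (F := fun=> 1) (fun=> ler01); rewrite sum_csize mulr1.
      by under eq_bigr => x _ do rewrite mulr1.
    rewrite le_eqVlt; apply/orP; left; apply/eqP; rewrite /w.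
    by field; rewrite !gt_eqF.
  under eq_bigr => a _ do rewrite iterE_sqr_sum ?dev_sum // big_nil expr0n /= add0r.
  rewrite -mulr_sumr exchange_big /=.
  have C0 : 0 <= 16 / (eps * cost X f c * N j * m%:R ^+ 2).
    by rewrite divr_ge0 ?mulr_ge0 ?cost_ge0 ?sqr_ge0 ?(ltW e0) ?(ltW j0).
  apply: le_trans (_ : 16 / (eps * cost X f c * N j * m%:R ^+ 2) *
     (m%:R * (N j / zeta * costj X f c j)) <= _).
    apply: ler_wpM2l => //; apply: ler_wpM2l => //.
    have := hit_sqr_le hj (F := fun x => sqdist (X x) (mu j)) (fun=> sqdist_ge0 _ _).
    have -> : \sum_x \sum_a aq x * dev j a x ^+ 2 =
        \sum_x aq x * (hit j x ^+ 2 * sqdist (X x) (mu j)).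
      apply: eq_bigr => x _; rewrite -mulr_sumr; congr (_ * _).
      by rewrite /sqdist mulr_sumr; apply: eq_bigr => a _; rewrite exprMn.
    move=> /le_trans; apply; rewrite ler_wpM2l ?cost_mean_le //.
    by rewrite divr_ge0 // ltW.
  have -> : 16 / (eps * cost X f c * N j * m%:R ^+ 2) =
      16 / (eps * cost X f c) * (N j * m%:R ^+ 2)^-1 by rewrite -mulrA invfM mulrA.
  rewrite le_eqVlt; apply/orP; left; apply/eqP; rewrite /w.
  move: (16 / (eps * cost X f c)) => u.
  by field; rewrite !gt_eqF.
(* The denominators add up to [4 * w * k], at most 1/20, and the numerators to [16 * w / eps], at
   most 16/40, because the costs of the clusters sum to the total cost. *)
rewrite iterE_sum; apply: le_trans (ler_sum _ bnd) _.
set B := 16 / _.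
have B0 : 0 <= B by rewrite divr_ge0 // mulr_ge0 ?cost_ge0 // ltW.
apply: le_trans (_ : \sum_j (4 * w + B * w * costj X f c j) <= _).
  rewrite [leRHS](bigID heavy) /= lerDl sumr_ge0 // => j _.
  apply: addr_ge0; first by rewrite mulr_ge0 // ltW.
  by rewrite mulr_ge0 ?costj_ge0 // mulr_ge0 // ltW.
rewrite big_split /= sumr_const card_ord -mulr_sumr -costE -[_ *+ k]mulr_natr.
have h1 : B * w * cost X f c <= 16 * w / eps.
  have [->|c0] := eqVneq (cost X f c) 0.
    by rewrite mulr0 divr_ge0 ?mulr_ge0 // ltW.
  rewrite le_eqVlt; apply/orP; left; apply/eqP; rewrite /B.
  by field; rewrite c0 gt_eqF.
have h2 : w / eps <= 40^-1.
  rewrite ler_pdivrMr // ler_pdivlMl //.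
  by apply: le_trans hw; rewrite ler_wpM2r ?(ltW w0) //; lra.
have -> : 4 * w * k%:R = (40 * k%:R * w) / 10 by field.
have : 16 * w / eps = 16 * (w / eps) by rewrite mulrA.
lra.
Qed.

Lemma good_of_bad xs (C : seq 'rV[R]_d) : size xs = m -> bad xs < 1 -> C != [::] ->
  (forall j, has (fun x => f x == j) xs -> wmean xs j \in C) ->
  Phi C X <= (1 + eps) * cost X f c.
Proof.
move=> sz hbad C0 hC; have /andP[e0 e1] := eps_bnd.
pose e j := if heavy j then
   4 / (m%:R ^+ 2 * N j) * \sum_a (\sum_(x <- xs) dev j a x) ^+ 2 else 0.
have t1 j : heavy j -> 0 <= 4 / (m%:R ^+ 2 * N j ^+ 2) * (\sum_(x <- xs) (hit j x - N j)) ^+ 2.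
  by move=> _; rewrite mulr_ge0 ?sqr_ge0 // divr_ge0 // mulr_ge0 ?sqr_ge0.
have q0 j : 0 <= \sum_a (\sum_(x <- xs) dev j a x) ^+ 2 by apply: sumr_ge0 => *; apply: sqr_ge0.
have t2 j : heavy j -> 0 <= 16 / (eps * cost X f c * N j * m%:R ^+ 2) *
     \sum_a (\sum_(x <- xs) dev j a x) ^+ 2.
  by move=> _; rewrite mulr_ge0 // divr_ge0 // !mulr_ge0 ?cost_ge0 ?csize_ge0 // ltW.
have e_ge0 j : 0 <= e j.
  rewrite /e; case: ifP => // _; rewrite mulr_ge0 // divr_ge0 // mulr_ge0 ?sqr_ge0 //.
  exact: csize_ge0.
apply: (@approx_cost _ _ _ _ X f c voronoi b eps z C e) => //.
  (* For zero cost the second terms of [bad] have coefficient 0 and say nothing; but then all points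
     of a cluster coincide with its mean and the deviations vanish. *)
  have [c0|c0] := eqVneq (cost X f c) 0.
    rewrite c0 mulr0 big1 // => j _; rewrite /e; case: ifP => // /andP[j0 _].
    rewrite big1 ?mulr0 // => a _; rewrite big1 ?expr0n // => x _.
    rewrite /dev /hit; case: eqP => [fx|]; last by rewrite !mul0r.
    suff -> : X x = mu j by rewrite subrr mulr0.
    apply: sqdist_eq0; apply/eqP; rewrite eq_le sqdist_ge0 andbT.
    rewrite -c0; apply: le_trans (costj_le X f c j).
    apply: le_trans (cost_mean_le X c j0).
    by rewrite (bigD1 x) ?fx //= lerDl sumr_ge0 // => *; apply: sqdist_ge0.
  have {}c0 : 0 < cost X f c by rewrite lt_def c0 cost_ge0.
  have ec0 : 0 < eps / 4 * cost X f c by apply: mulr_gt0 => //; apply: divr_gt0.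
  rewrite -[leRHS]mulr1 -ler_pdivrMl //.
  apply: le_trans (ltW hbad); rewrite mulr_sumr /bad [leRHS]big_mkcond /=.
  apply: ler_sum => j _; rewrite /e; case: ifP => [hj|]; last by rewrite mulr0.
  have /andP[j0 _] := hj; apply: le_trans (_ : _ <= 0 + _) (lerD (t1 j hj) (lexx _)).
  rewrite add0r le_eqVlt; apply/orP; left; apply/eqP.
  by field; rewrite !gt_eqF.
move=> x; have [hj|/not_heavy[y [fy h1 h2]]] := boolP (heavy (f x)); last first.
  by left; exists y.
right; have /andP[j0 _] := hj; set j := f x in hj j0 *.
pose W := \sum_(y <- xs) hit j y.
(* A denominator below half its expectation would make its own term in [bad] at least 1. In
   particular [W > 0], so the cluster has been sampled and its weighted mean lies in [C]. *)
have hW : m%:R * N j / 2 <= W.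
  rewrite leNgt; apply/negP => hW.
  have := le_lt_trans _ hbad; rewrite /bad (bigD1 j) //= => /(_ 1) h.
  suff : 1 < 1 :> R by rewrite ltxx.
  apply: h; apply: le_trans (_ : _ + 0 <= _); last first.
    by apply: lerD; [apply: lerD; [exact: lexx|exact: (t2 j hj)]|
      apply: sumr_ge0 => l /andP[hl _]; rewrite addr_ge0 ?t1 ?t2].
  have -> : \sum_(y <- xs) (hit j y - N j) = W - m%:R * N j.
    by rewrite sumrB big_const_seq count_predT sz iter_addr_0 mulr_natl.
  rewrite !addr0 mulrAC ler_pdivlMr ?mulr_gt0 ?exprn_gt0 // mul1r -exprMn.
  have -> : 4 * (W - m%:R * N j) ^+ 2 = (2 * (m%:R * N j - W)) ^+ 2 by ring.
  have p0 : 0 < m%:R * N j by rewrite mulr_gt0.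
  by rewrite ler_pXn2r ?nnegrE ?(ltW p0) //; lra.
have p0 : 0 < m%:R * N j by rewrite mulr_gt0.
have W0 : 0 < W by apply: lt_le_trans hW; rewrite divr_gt0.
have hitw y : hit j y = awS * ((f y == j)%:R / aw y).
  by rewrite /hit /aq invf_div mulrCA mulrA.
exists (wmean xs j).
  apply: hC; apply: contraLR isT => hn; exfalso; move: W0.
  rewrite /W big1_seq ?ltxx // => y /= yxs.
  rewrite /hit; case: eqP => [fy|_]; last by rewrite mul0r.
  by case/negP: hn; apply/hasP; exists y; rewrite ?fy.
have hdev a : mu j 0 a - wmean xs j 0 a = - (\sum_(y <- xs) dev j a y) / W.
  have -> : \sum_(y <- xs) dev j a y = \sum_(y <- xs) hit j y * X y 0 a - mu j 0 a * W.
    by rewrite /W mulr_sumr -sumrB; apply: eq_bigr => y _; rewrite /dev; ring.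
  have -> : wmean xs j 0 a = (\sum_(y <- xs) hit j y * X y 0 a) / W.
    rewrite mxE /W; under [X in _ = X / _]eq_bigr => y _ do rewrite hitw -mulrA.
    under [X in _ = _ / X]eq_bigr => y _ do rewrite hitw.
    rewrite -!mulr_sumr -mulf_div divff ?mul1r ?gt_eqF ?awS_gt0 //.
    by congr (_ / _); rewrite big_mkcond; apply: eq_bigr => y _;
      case: (f y == j); rewrite ?mul0r ?mul1r // mulrC.
  by field; rewrite gt_eqF.
rewrite /e hj /sqdist; under eq_bigr => a _ do rewrite hdev mulNr sqrrN expr_div_n.
rewrite -mulr_suml [N j * _]mulrCA mulrC; apply: ler_wpM2r => //.
rewrite ler_pdivrMr ?exprn_gt0 //.
have -> : 4 / (m%:R ^+ 2 * N j) * W ^+ 2 = N j * (2 * W / (m%:R * N j)) ^+ 2.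
  by field; rewrite !gt_eqF.
rewrite -[leLHS]mulr1 ler_pM2l // -[leLHS](expr1n _ 2) ler_pXn2r ?nnegrE //; last first.
- by rewrite divr_ge0 ?mulr_ge0 // ltW.
- by rewrite ler_pdivlMr //; lra.
Qed.

(** Markov's inequality in pointwise form: [1 - bad xs <= h xs] for every sample, integrated with
    [E_bad]. *)
Lemma recovery (h : seq 'I_n -> R) : (forall xs, 0 <= h xs) ->
  (forall xs, size xs = m ->
     (forall C, C != [::] -> (forall j, has (fun x => f x == j) xs -> wmean xs j \in C) ->
        Phi C X <= (1 + eps) * cost X f c) -> 1 <= h xs) ->
  2^-1 <= iterE aq m h [::].
Proof.
move=> h0 h1; apply: le_trans (_ : iterE aq m (fun xs => 1 + (-1) * bad xs) [::] <= _).
  rewrite iterED iterEZ iterE_cst; last exact: aq_sum.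
  have := E_bad; lra.
apply: le_iterE => [a|xs]; first by rewrite ltW ?aq_gt0.
rewrite addn0 => sz; have [hb|hb] := ltP (bad xs) 1; last by have := h0 xs; lra.
have bad0 : 0 <= bad xs.
  apply: sumr_ge0 => j _; have /andP[e0 _] := eps_bnd; apply: addr_ge0; apply: mulr_ge0;
    rewrite ?sqr_ge0 ?divr_ge0 ?mulr_ge0 ?sqr_ge0 ?cost_ge0 ?csize_ge0 ?(ltW e0) //.
  by apply: sumr_ge0 => *; apply: sqr_ge0.
have := h1 xs sz (fun C C0 hC => good_of_bad sz hb C0 hC); lra.
Qed.

End Recovery.

(** * Seeding by D^2-sampling *)

Section Seeding.
Variables (R : realType) (d n k : nat).
Variables (X : 'I_n -> 'rV[R]_d) (f : 'I_n -> 'I_k) (c : 'I_k -> 'rV[R]_d).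
Variable i0 : 'I_n.
Implicit Types (b : 'I_n -> 'I_n) (v : ('I_n -> 'I_n) -> R).

(* The law of [sample_cmd] below, whose initial choice [i0] survives if all the
   weights vanish. *)
Definition sdist (w : 'I_n -> R) (x : 'I_n) : R :=
  if \sum_i w i == 0 then (x == i0)%:R else w x / \sum_i w i.

Lemma sdist_ge0 w x : (forall i, 0 <= w i) -> 0 <= sdist w x.
Proof.
move=> w0; rewrite /sdist; case: ifP => // _.
by rewrite divr_ge0 // sumr_ge0.
Qed.

Lemma sdist_sum w : \sum_x sdist w x = 1.
Proof.
rewrite /sdist; case: eqP => [_|/eqP h]; last by rewrite -mulr_suml divff.
by rewrite (bigD1 i0) //= eqxx big1 ?addr0 // => x /negbTE ->.
Qed.

Definition upd b (a x : 'I_n) : 'I_n :=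
  if sqdist (X x) (X a) <= adist X b x then a else b x.

Definition nearest b := forall x y, adist X b x <= sqdist (X x) (X (b y)).

Definition few (s : nat) b := exists cs : seq 'I_n,
  (size cs <= s)%N /\ forall x, b x \in cs.

Lemma upd_le b a x : adist X (upd b a) x <= adist X b x.
Proof. by rewrite /adist /upd; case: ifP. Qed.

Lemma upd_le_new b a x : adist X (upd b a) x <= sqdist (X x) (X a).
Proof.
rewrite /adist /upd; case: ifP => // /negbT; rewrite -ltNge; exact: ltW.
Qed.

Lemma nearest_upd b a : nearest b -> nearest (upd b a).
Proof.
move=> hb x y; rewrite {2}/upd; case: ifP => _; first exact: upd_le_new.
exact: le_trans (upd_le _ _ _) (hb x y).
Qed.

Lemma few_upd s b a : few s b -> few s.+1 (upd b a).
Proof.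
case=> cs [h1 h2]; exists (a :: cs); split=> // x.
by rewrite /upd inE; case: ifP; rewrite ?eqxx ?h2 ?orbT.
Qed.

Lemma acost_upd b a : acost X (upd b a) <= acost X b.
Proof. by apply: ler_sum => x _; apply: upd_le. Qed.

(** Expected value of [v] after [s] more rounds. Unlike in [iterE], the law of each draw depends on
    the current anchors. *)
Fixpoint iterV (s : nat) v b : R :=
  if s is s'.+1 then \sum_a sdist (adist X b) a * iterV s' v (upd b a) else v b.

Definition acostj b (j : 'I_k) : R := \sum_(i | f i == j) adist X b i.

Lemma acostj_ge0 b j : 0 <= acostj b j.
Proof. by apply: sumr_ge0 => x _; apply: adist_ge0. Qed.

Lemma acostj_upd b a j : acostj (upd b a) j <= acostj b j.
Proof. by apply: ler_sum => x _; apply: upd_le. Qed.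

(** If [E a] is the cost of the cluster with center [X a], then [N * adist a] is at most
    [2 * D + 2 * E a], and the new cost is at most both [D] and [E a]. So each product, times [N],
    is at most [4 * D * E a]. The [E a] sum to at most [4 * N] times the optimal cost of the
    cluster, and 4 * 4 = 16. *)
Lemma acost_seed b j : nearest b ->
  \sum_(a | f a == j) adist X b a * acostj (upd b a) j <=
  16 * costj X f c j * acostj b j.
Proof.
move=> hb; have [x /eqP xj|j0] := pickP (fun x => f x == j); last first.
  by rewrite big_pred0 // mulr_ge0 ?acostj_ge0 // mulr_ge0 // costj_ge0.
have N0 : 0 < csize R f j by rewrite -xj csize_gt0.
set N := csize R f j in N0; set D := acostj b j.
pose E a := \sum_(x | f x == j) sqdist (X x) (X a).
have sumc (u : R) : \sum_(x | f x == j) u = N * u.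
  by rewrite /N /csize mulr_suml; apply: eq_bigr => y _; rewrite mul1r.
have hE : \sum_(a | f a == j) E a <= 4 * N * costj X f c j.
  apply: le_trans (_ : \sum_(a | f a == j) (2 * costj X f c j + 2 * N * sqdist (X a) (c j)) <= _).
    apply: ler_sum => a _; rewrite /E.
    apply: le_trans (_ : \sum_(x | f x == j) (2 * sqdist (X x) (c j) + 2 * sqdist (X a) (c j)) <= _).
      by apply: ler_sum => y _; rewrite (sqdistC (X a)); apply: sqdist_tri2.
    rewrite big_split /= sumc -mulr_sumr -/(costj _ _ _ j); lra.
  rewrite big_split /= sumc -mulr_sumr -/(costj _ _ _ j); lra.
have hD a : N * adist X b a <= 2 * D + 2 * E a.
  rewrite -sumc /D /acostj /E !mulr_sumr -big_split /=; apply: ler_sum => y _.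
  apply: le_trans (hb a y) _; apply: le_trans (sqdist_tri2 _ (X y) _) _.
  by rewrite addrC (sqdistC (X a)).
rewrite -(ler_pM2l N0) mulr_sumr.
apply: le_trans (_ : \sum_(a | f a == j) 4 * D * E a <= _).
  apply: ler_sum => a _; rewrite mulrA.
  have D0 : 0 <= D := acostj_ge0 b j.
  have A0 := acostj_ge0 (upd b a) j; have A1 := acostj_upd b a j; rewrite -/D in A1.
  have A2 : acostj (upd b a) j <= E a by apply: ler_sum => y _; apply: upd_le_new.
  have E0 := le_trans A0 A2.
  apply: le_trans (ler_wpM2r A0 (hD a)) _.
  have : D * acostj (upd b a) j <= D * E a by rewrite ler_wpM2l.
  have : E a * acostj (upd b a) j <= E a * D by rewrite ler_wpM2l.
  lra.
rewrite -mulr_sumr; apply: le_trans (ler_wpM2l _ hE) _.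
  by rewrite mulr_ge0 // acostj_ge0.
rewrite -/D; lra.
Qed.

Definition uncov b j := 32 * costj X f c j < acostj b j.
Definition nuncov b : R := \sum_j (uncov b j)%:R.

Lemma uncov_upd b a j : uncov (upd b a) j -> uncov b j.
Proof. by move=> /lt_le_trans; apply; apply: acostj_upd. Qed.

(** Markov's inequality: a D^2-sample inside the cluster leaves an expected cost of at most 16 times
    the optimal one, hence more than 32 times it with probability at most 1/2. *)
Lemma cover_half b j : nearest b ->
  2^-1 * acostj b j <= \sum_(a | f a == j) adist X b a * (~~ uncov (upd b a) j)%:R.
Proof.
move=> hb; have D0 a := adist_ge0 X b a.
suff h : \sum_(a | f a == j) adist X b a * (uncov (upd b a) j)%:R <= 2^-1 * acostj b j.
  have -> : \sum_(a | f a == j) adist X b a * (~~ uncov (upd b a) j)%:R =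
    acostj b j - \sum_(a | f a == j) adist X b a * (uncov (upd b a) j)%:R.
    rewrite /acostj -sumrB; apply: eq_bigr => a _.
    by case: (uncov _ _); rewrite ?mulr1 ?mulr0 ?subrr ?subr0.
  lra.
have hs := acost_seed j hb.
have term a : 32 * costj X f c j * (adist X b a * (uncov (upd b a) j)%:R)
    <= adist X b a * acostj (upd b a) j.
  rewrite mulrCA ler_wpM2l //; case: (boolP (uncov _ _)) => [/ltW|_].
    by rewrite mulr1.
  by rewrite mulr0 acostj_ge0.
have [c0|c0] := eqVneq (costj X f c j) 0; last first.
  have {}c0 : 0 < costj X f c j by rewrite lt_def c0 costj_ge0.
  have c1 : 0 < 32 * costj X f c j by rewrite mulr_gt0.
  rewrite -(ler_pM2l c1) mulr_sumr.
  apply: le_trans (ler_sum _ (fun a _ => term a)) _.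
  by apply: le_trans hs _; lra.
(* With zero optimal cost one cannot divide by the threshold. But then [acost_seed] makes every
   product vanish, so a point that leaves some cost has weight zero. *)
apply: le_trans (_ : 0 <= _); last by rewrite mulr_ge0 ?acostj_ge0 // invr_ge0.
rewrite big1 // => a fa; case: (boolP (uncov _ _)); rewrite ?mulr0 // mulr1 /uncov c0 mulr0.
move=> u0; apply/eqP; rewrite eq_le D0 andbT -(ler_pM2r u0) mul0r.
have {hs} : \sum_(a | f a == j) adist X b a * acostj (upd b a) j <= 0.
  by apply: le_trans hs _; rewrite c0 mulr0 mul0r.
apply: le_trans; rewrite (bigD1 a) //= lerDl sumr_ge0 // => y _.
by rewrite mulr_ge0 ?acostj_ge0.
Qed.

Lemma nuncov_drop b : nearest b -> 64 * cost X f c < acost X b ->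
  \sum_a sdist (adist X b) a * nuncov (upd b a) <= nuncov b - 4^-1.
Proof.
move=> hb hc; have A0 : 0 < acost X b.
  by apply: le_lt_trans hc; rewrite mulr_ge0 ?cost_ge0.
have D0 a := adist_ge0 X b a.
have sE a : sdist (adist X b) a = adist X b a / acost X b.
  by rewrite /sdist -/(acost X b) gt_eqF.
pose new a j := [&& f a == j, uncov b j & ~~ uncov (upd b a) j].
have step a : nuncov (upd b a) <= nuncov b - \sum_j (new a j)%:R.
  rewrite /nuncov -sumrB; apply: ler_sum => j _; rewrite /new.
  case: (boolP (uncov (upd b a) j)) => [/uncov_upd ->|_]; first by rewrite !andbF subr0.
  by case: (f a == j); case: (uncov b j); rewrite /= ?subrr ?subr0.
apply: le_trans (_ : \sum_a sdist (adist X b) a * (nuncov b - \sum_j (new a j)%:R) <= _).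
  by apply: ler_sum => a _; rewrite ler_wpM2l ?sdist_ge0.
under eq_bigr => a _ do rewrite mulrBr.
rewrite sumrB -mulr_suml sdist_sum mul1r lerD2l lerN2.
under eq_bigr => a _ do rewrite sE mulrAC.
rewrite -mulr_suml ler_pdivlMr //.
under eq_bigr => a _ do rewrite mulr_sumr.
rewrite exchange_big /=.
have hj j : (uncov b j)%:R * (2^-1 * acostj b j) <= \sum_a adist X b a * (new a j)%:R.
  have [u|u] := boolP (uncov b j); last first.
    by rewrite mul0r sumr_ge0 // => a _; rewrite mulr_ge0.
  rewrite mul1r; apply: le_trans (cover_half j hb) _; rewrite big_mkcond /=.
  by apply: ler_sum => a _; rewrite /new u; case: (f a == j); rewrite ?mulr0.
apply: le_trans (ler_sum _ (fun j _ => hj j)).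
have hA : acost X b = \sum_j acostj b j by rewrite /acost (sum_fibers f).
(* The covered clusters hold at most [32 * cost], less than half of [acost]. The other half is
   multiplied by 1/2 from [cover_half], which gives the drop of 1/4. *)
have hcov : \sum_j (~~ uncov b j)%:R * acostj b j <= 32 * cost X f c.
  rewrite costE mulr_sumr; apply: ler_sum => j _.
  case: (boolP (uncov b j)) => [_|]; first by rewrite mul0r mulr_ge0 ?costj_ge0.
  by rewrite /uncov -leNgt mul1r.
have hsum : acost X b = \sum_j (uncov b j)%:R * acostj b j + \sum_j (~~ uncov b j)%:R * acostj b j.
  rewrite hA -big_split /=; apply: eq_bigr => j _.
  by case: (uncov b j); rewrite ?mul1r ?mul0r ?addr0 ?add0r.
under eq_bigr => j _ do rewrite mulrCA.
rewrite -mulr_sumr; lra.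
Qed.

Lemma good_stays s r v b : few r b ->
  (forall b', few (s + r) b' -> acost X b' <= 64 * cost X f c -> 2^-1 <= v b') ->
  acost X b <= 64 * cost X f c -> 2^-1 <= iterV s v b.
Proof.
elim: s r b => [|s IH] r b hr hv hb /=; first exact: hv.
apply: le_trans (_ : \sum_a sdist (adist X b) a * 2^-1 <= _).
  by rewrite -mulr_suml sdist_sum mul1r.
apply: ler_sum => a _; rewrite ler_wpM2l ?sdist_ge0 // => [i|]; first exact: adist_ge0.
apply: (IH r.+1); [exact: few_upd| |exact: le_trans (acost_upd _ _) hb].
by move=> b'; rewrite addnS -addSn; apply: hv.
Qed.

Lemma iterV_ge0 s v b : (forall b', 0 <= v b') -> 0 <= iterV s v b.
Proof.
move=> v0; elim: s b => //= s IH b; apply: sumr_ge0 => a _.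
by rewrite mulr_ge0 // sdist_ge0 // => i; apply: adist_ge0.
Qed.

(** Division-free form of a stopping time argument. The expected number of rounds spent above
    [64 * cost] is at most [4 * nuncov b], so all [s] rounds are spent there with probability at
    most [4 * nuncov b / s]; otherwise [v] contributes 1/2. *)
Lemma seeding_potential s r v b : nearest b -> few r b -> (forall b', 0 <= v b') ->
  (forall b', few (s + r) b' -> acost X b' <= 64 * cost X f c -> 2^-1 <= v b') ->
  2^-1 * (s%:R - 4 * nuncov b) <= s%:R * iterV s v b.
Proof.
move=> nb hr v0; elim: s r b nb hr => [|s IH] r b nb hr hv.
  rewrite sub0r mul0r; have : 0 <= nuncov b by apply: sumr_ge0.
  lra.
have u0 : 0 <= nuncov b by apply: sumr_ge0.
have [hb|hb] := leP (acost X b) (64 * cost X f c).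
  have h := good_stays hr hv hb.
  have : s.+1%:R * 2^-1 <= s.+1%:R * iterV s.+1 v b by rewrite ler_wpM2l.
  lra.
have V0 := iterV_ge0 s.+1 b v0.
have eS : s.+1%:R = s%:R + 1 :> R by rewrite natr1.
(* One of the [s + 1] copies of the nonnegative value is given away, so that the induction
   hypothesis applies to the other [s]; the expected drop of [nuncov] compensates for it. *)
rewrite [X in _ <= X * _]eS [leRHS]mulrDl mul1r.
apply: (@le_trans _ _ (s%:R * iterV s.+1 v b)); last by rewrite lerDl.
rewrite /= [leRHS]mulr_sumr.
apply: le_trans (_ : \sum_a (sdist (adist X b) a * (2^-1 * s%:R)
    - 2 * (sdist (adist X b) a * nuncov (upd b a))) <= _).
  rewrite sumrB -mulr_suml sdist_sum -[X in _ <= _ - X]mulr_sumr.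
  have := nuncov_drop nb hb; rewrite -[s.+1%:R]natr1; lra.
apply: ler_sum => a _; rewrite mulrCA.
have q0 : 0 <= sdist (adist X b) a by apply: sdist_ge0 => i; apply: adist_ge0.
have := ler_wpM2l q0 (IH r.+1 (upd b a) (nearest_upd a nb) (few_upd a hr) _).
have hv' b' : few (s + r.+1) b' -> acost X b' <= 64 * cost X f c -> 2^-1 <= v b'.
  by rewrite addnS -addSn; apply: hv.
by move=> /(_ hv'); lra.
Qed.

Lemma nuncov_le b : nuncov b <= k%:R.
Proof.
apply: le_trans (_ : \sum_(j < k) 1 <= _); last by rewrite sumr_const card_ord.
by apply: ler_sum => j _; rewrite lern1 leq_b1.
Qed.

(** At most [k] clusters are uncovered initially, so 8k rounds leave 1 - 4k/(8k) = 1/2, times the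
    1/2 guaranteed by [v]. *)
Lemma seeding v : (0 < k)%N -> (forall b, 0 <= v b) ->
  (forall b, few (8 * k).+1 b -> acost X b <= 64 * cost X f c -> 2^-1 <= v b) ->
  4^-1 <= iterV (8 * k) v (fun=> i0).
Proof.
move=> k0 v0 hv; have k1 : 0 < k%:R :> R by rewrite ltr0n.
have h1 : nearest (fun=> i0) by move=> x y; apply: lexx.
have h2 : few 1 (fun=> i0) by exists [:: i0]; split=> // x; rewrite mem_head.
have := seeding_potential (s := 8 * k) h1 h2 v0; rewrite addn1 => /(_ hv).
have := nuncov_le (fun=> i0); rewrite natrM => u1 h.
have : 8 * k%:R * 4^-1 <= 8 * k%:R * iterV (8 * k) v (fun=> i0) by lra.
by rewrite ler_pM2l // mulr_gt0.
Qed.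

End Seeding.

(** * A program logic *)

Section Logic.
Variables (R : realType) (orc : nat -> nat -> bool) (Q E : state R -> Prop).
Implicit Types (s : state R) (v : R) (c : cmd) (K : seq cmd).

Definition achieves (T : nat) (cfg : config R) (v : R) : Prop :=
  always orc T cfg Q /\ v <= Pr orc T cfg E.

Lemma always_Pr_mono T T' cfg : (T <= T')%N -> always orc T cfg Q ->
  always orc T' cfg Q /\ Pr orc T' cfg E = Pr orc T cfg E.
Proof.
elim: T T' cfg => [|T IH] [|T'] cfg //=; rewrite ?ltnS; case: (Defs.next orc cfg) => //.
- by move=> cfg' h /(IH _ _ h).
- by move=> p c1 c2 h [/(IH _ _ h)[? ->] /(IH _ _ h)[? ->]].
Qed.

Lemma achievesW T T' v v' cfg : (T <= T')%N -> v' <= v ->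
  achieves T cfg v -> achieves T' cfg v'.
Proof.
move=> hT hv [/(always_Pr_mono hT)[h1 h2] h3].
by split=> //; rewrite h2 (le_trans hv).
Qed.

Lemma achieves_step T cfg cfg' v : Defs.next orc cfg = Step cfg' ->
  achieves T cfg' v -> achieves T.+1 cfg v.
Proof. by move=> h; rewrite /achieves /= h. Qed.

(* The postcondition relates a final state to the success probability that the
   rest of the program has to guarantee from there. *)
Definition pexec (t : nat) c s v (Post : state R -> R -> Prop) : Prop :=
  forall K T, (forall s' v', Post s' v' -> achieves T (K, s') v') ->
    achieves (t + T) (c :: K, s) v.

(** For code without coin flips: the probability still owed is the same before and after, whatever
    it is. *)
Definition exec (t : nat) c s (P : state R -> Prop) : Prop :=
  forall v, pexec t c s v (fun s' v' => v' = v /\ P s').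

Lemma pexecW t t' c s v (P P' : state R -> R -> Prop) : (t <= t')%N ->
  (forall s' v', P s' v' -> P' s' v') -> pexec t c s v P -> pexec t' c s v P'.
Proof.
move=> ht hP h K T hK; apply: (@achievesW (t + T) _ v) => //; first by rewrite leq_add2r.
by apply: h => s' v' /hP; apply: hK.
Qed.

Lemma execW t t' c s (P P' : state R -> Prop) : (t <= t')%N ->
  (forall s', P s' -> P' s') -> exec t c s P -> exec t' c s P'.
Proof.
by move=> ht hP h v; apply: pexecW ht _ (h v) => s' v' [-> /hP].
Qed.

Lemma exec_leq t t' c s P : (t <= t')%N -> exec t c s P -> exec t' c s P.
Proof. by move=> ht; apply: execW. Qed.

Lemma pexec_exec t c s v P (Post : state R -> R -> Prop) :
  exec t c s P -> (forall s', P s' -> Post s' v) -> pexec t c s v Post.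
Proof. by move=> h hP; apply: pexecW (leqnn _) _ (h v) => s' v' [-> /hP]. Qed.

Lemma pexec_skip s v (Post : state R -> R -> Prop) : Post s v -> pexec 1 Skip s v Post.
Proof. by move=> h K T hK; rewrite add1n; apply: achieves_step => //=; apply: hK. Qed.

Lemma pexec_istore a i e s v (Post : state R -> R -> Prop) :
  Post (set_int s a (ieval s i) (ieval s e)) v -> pexec 1 (IStore a i e) s v Post.
Proof. by move=> h K T hK; rewrite add1n; apply: achieves_step => //=; apply: hK. Qed.

Lemma pexec_rstore a i e s v (Post : state R -> R -> Prop) :
  Post (set_real s a (ieval s i) (reval s e)) v -> pexec 1 (RStore a i e) s v Post.
Proof. by move=> h K T hK; rewrite add1n; apply: achieves_step => //=; apply: hK. Qed.

Lemma pexec_query a i e1 e2 s v (Post : state R -> R -> Prop) :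
  Post (set_int (add_query s) a (ieval s i) (orc (ieval s e1) (ieval s e2))) v ->
  pexec 1 (Query a i e1 e2) s v Post.
Proof. by move=> h K T hK; rewrite add1n; apply: achieves_step => //=; apply: hK. Qed.

Lemma pexec_flip a i e s v v1 v2 (Post : state R -> R -> Prop) (p := clamp01 (reval s e)) :
  Post (set_int s a (ieval s i) 1) v1 -> Post (set_int s a (ieval s i) 0) v2 ->
  v <= p * v1 + (1 - p) * v2 -> pexec 1 (Flip a i e) s v Post.
Proof.
move=> h1 h2 hv K T hK; rewrite add1n.
have [a1 b1] := hK _ _ h1; have [a2 b2] := hK _ _ h2.
split=> //=; rewrite -/p; apply: le_trans hv _.
have p0 : 0 <= p by rewrite /p /clamp01 le_min le_max lexx ler01.
have p1 : 0 <= 1 - p by rewrite subr_ge0 /p /clamp01 ge_min lexx.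
by rewrite lerD // ler_wpM2l.
Qed.

Lemma pexec_seq t1 t2 c1 c2 s v (P1 Post : state R -> R -> Prop) :
  pexec t1 c1 s v P1 -> (forall s' v', P1 s' v' -> pexec t2 c2 s' v' Post) ->
  pexec (t1 + t2).+1 (Seq c1 c2) s v Post.
Proof.
move=> h1 h2 K T hK; rewrite addSn -addnA; apply: achieves_step => //=.
by apply: h1 => s' v' /h2; apply.
Qed.

Lemma pexec_if t b c1 c2 s v (Post : state R -> R -> Prop) :
  pexec t (if beval s b then c1 else c2) s v Post -> pexec t.+1 (If b c1 c2) s v Post.
Proof. by move=> h K T hK; rewrite addSn; apply: achieves_step => //=; apply: h. Qed.

(** The index of [Inv] counts the iterations still to come, so it serves both as termination measure
    and as time budget. *)
Lemma pexec_while t b c (Inv : nat -> state R -> R -> Prop)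
    (Post : state R -> R -> Prop) m s v :
  (forall i s v, Inv i s v -> if beval s b
     then exists2 i', i = i'.+1 & pexec t c s v (Inv i') else Post s v) ->
  Inv m s v -> pexec (m * t.+1).+1 (While b c) s v Post.
Proof.
move=> hI; elim/ltn_ind: m s v => m IH s v /[dup] h0 /hI h K T hK.
rewrite addSn; case: ifP h => hb.
  case=> i' em hc; subst m.
  apply: (@achieves_step _ _ (c :: While b c :: K, s)); first by rewrite /= hb.
  rewrite mulSn -addnA addSnnS; apply: hc => s' v' hs'.
  by rewrite -addSn; apply: IH hs' _ _ hK.
move=> hP; apply: (@achieves_step _ _ (K, s)); first by rewrite /= hb.
by apply: achievesW (hK _ _ hP) => //; apply: leq_addl.
Qed.

Definition iv (a : nat) : iexp := ILoad a (ICst 0).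
Definition rv (a : nat) : rexp := RLoad a (ICst 0).

Definition for_cmd (a : nat) (e : iexp) (c : cmd) : cmd :=
  Seq (IStore a (ICst 0) (ICst 0))
    (While (BNot (BLeI e (iv a)))
       (Seq c (IStore a (ICst 0) (IAdd (iv a) (ICst 1))))).

Lemma pexec_for t a e c (Inv : nat -> state R -> R -> Prop)
    (Post : state R -> R -> Prop) m s v :
  (forall i s v, Inv i s v -> ieval s e = m) ->
  (forall i s v, (i < m)%N -> imem s a 0 = i -> Inv i s v ->
     pexec t c s v (fun s' v' => imem s' a 0 = i /\ Inv i.+1 (set_int s' a 0 i.+1) v')) ->
  Inv 0 (set_int s a 0 0) v ->
  (forall s v, Inv m s v -> Post s v) ->
  pexec (m * (t + 3) + 3) (for_cmd a e c) s v Post.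
Proof.
move=> he hc h0 hP.
pose J i s v := [/\ (i <= m)%N, imem s a 0 = (m - i)%N & Inv (m - i)%N s v].
have -> : (m * (t + 3) + 3 = (1 + (m * (t + 1).+2).+1).+1)%N by lia.
apply: pexec_seq.
  by apply: (pexec_istore (Post := fun s' v' => s' = set_int s a 0 0 /\ v' = v)).
move=> _ _ [-> ->]; apply: (pexec_while (Inv := J)); last first.
  by split; rewrite ?subnn //= /update !eqxx.
move=> i s1 v1 [hi ea hI] /=; rewrite (he _ _ _ hI) -ltnNge ea.
case: ifP => him; last first.
  by apply: hP; rewrite -[X in Inv X](_ : (m - i)%N = m) //; lia.
have i0 : (0 < i)%N by lia.
exists i.-1; first by rewrite prednK.
apply: pexec_seq (hc _ _ _ him ea hI) _ => s2 v2 [ea2 hI2].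
apply: pexec_istore; rewrite /= ea2 addn1.
have -> : ((m - i).+1 = m - i.-1)%N by lia.
split; [by lia|by rewrite /= /update !eqxx|].
by rewrite -(_ : (m - i).+1 = m - i.-1)%N //; lia.
Qed.

Lemma exec_skip s (P : state R -> Prop) : P s -> exec 1 Skip s P.
Proof. by move=> h v; apply: pexec_skip. Qed.

Lemma exec_istore a i e s (P : state R -> Prop) :
  P (set_int s a (ieval s i) (ieval s e)) -> exec 1 (IStore a i e) s P.
Proof. by move=> h v; apply: pexec_istore. Qed.

Lemma exec_rstore a i e s (P : state R -> Prop) :
  P (set_real s a (ieval s i) (reval s e)) -> exec 1 (RStore a i e) s P.
Proof. by move=> h v; apply: pexec_rstore. Qed.

Lemma exec_query a i e1 e2 s (P : state R -> Prop) :
  P (set_int (add_query s) a (ieval s i) (orc (ieval s e1) (ieval s e2))) ->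
  exec 1 (Query a i e1 e2) s P.
Proof. by move=> h v; apply: pexec_query. Qed.

Lemma exec_seq t1 t2 c1 c2 s (P1 P : state R -> Prop) :
  exec t1 c1 s P1 -> (forall s', P1 s' -> exec t2 c2 s' P) ->
  exec (t1 + t2).+1 (Seq c1 c2) s P.
Proof. by move=> h1 h2 v; apply: pexec_seq (h1 v) _ => s' v' [-> /h2]; apply. Qed.

Lemma exec_if t b c1 c2 s (P : state R -> Prop) :
  exec t (if beval s b then c1 else c2) s P -> exec t.+1 (If b c1 c2) s P.
Proof. by move=> h v; apply: pexec_if. Qed.

Lemma exec_for t a e c (Inv : nat -> state R -> Prop) (P : state R -> Prop) m s :
  (forall i s, Inv i s -> ieval s e = m) ->
  (forall i s, (i < m)%N -> imem s a 0 = i -> Inv i s ->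
     exec t c s (fun s' => imem s' a 0 = i /\ Inv i.+1 (set_int s' a 0 i.+1))) ->
  Inv 0 (set_int s a 0 0) -> (forall s, Inv m s -> P s) ->
  exec (m * (t + 3) + 3) (for_cmd a e c) s P.
Proof.
move=> he hc h0 hP v.
apply: (pexec_for (Inv := fun i s v' => v' = v /\ Inv i s)) => //.
- by move=> i s1 v1 [_ /he].
- move=> i s1 v1 hi ea [-> hI].
  by apply: pexec_exec (hc _ _ hi ea hI) _ => s' [].
- by move=> s1 v1 [-> /hP].
Qed.

Definition frame (q : nat) (I J : seq nat) (s s' : state R) : Prop :=
  [/\ forall a i, a \notin I -> imem s' a i = imem s a i,
      forall a i, a \notin J -> rmem s' a i = rmem s a i
    & (nqueries s' <= nqueries s + q)%N].

Lemma frame_refl q I J s : frame q I J s s.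
Proof. by split=> //; apply: leq_addr. Qed.

Lemma frame_trans q1 q2 I J s1 s2 s3 :
  frame q1 I J s1 s2 -> frame q2 I J s2 s3 -> frame (q1 + q2) I J s1 s3.
Proof.
move=> [a1 b1 c1] [a2 b2 c2]; split=> [a i h|a i h|]; rewrite ?a2 ?b2 ?a1 ?b1 //.
by rewrite addnA (leq_trans c2) // leq_add2r.
Qed.

Lemma frameW q q' I I' J J' s s' : (q <= q')%N -> {subset I <= I'} -> {subset J <= J'} ->
  frame q I J s s' -> frame q' I' J' s s'.
Proof.
move=> hq hI hJ [a1 b1 c1]; split=> [a i h|a i h|].
- by apply: a1; apply: contra h; apply: hI.
- by apply: b1; apply: contra h; apply: hJ.
- by rewrite (leq_trans c1) // leq_add2l.
Qed.

Lemma frame_int q I J s s' a i x : a \in I -> frame q I J s s' ->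
  frame q I J s (set_int s' a i x).
Proof.
move=> ha [h1 h2 h3]; split=> //= b j hb; rewrite /update -h1 //.
by case: eqP hb => // ->; rewrite ha.
Qed.

Lemma frame_real q I J s s' a i x : a \in J -> frame q I J s s' ->
  frame q I J s (set_real s' a i x).
Proof.
move=> ha [h1 h2 h3]; split=> //= b j hb; rewrite /update -h2 //.
by case: eqP hb => // ->; rewrite ha.
Qed.

Lemma updateE (T : Type) (mm : nat -> nat -> T) a i (w : T) i' :
  update mm a i w a i' = if i' == i then w else mm a i'.
Proof. by rewrite /update eqxx. Qed.

End Logic.

(** * The program *)

Definition nE : iexp := ILoad 0 (ICst 0).
Definition dE : iexp := ILoad 0 (ICst 1).
Definition kE : iexp := ILoad 0 (ICst 2).
Definition row_exp (l : iexp) (j : iexp) : iexp := IAdd (IMul l dE) j.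

Definition orb_exp (b1 b2 : bexp) : bexp := BNot (BAnd (BNot b1) (BNot b2)).

(* Integer arrays: 1 current sample, 2, 3, 6, 8, 9, 13 loop counters, 4 anchors,
   5 coin, 7 cell sizes, 10 whether the sample has been placed, 11 slot
   representatives, 12 query answer, 14 whether the center is a duplicate.
   Real arrays: 3 distances to the anchors, 4, 5, 6, 10 accumulators, 7 weights,
   8 total weights of the slots, 9 weighted sums of the slots. *)

Definition dist_cmd (A x1 x2 : nat) : cmd :=
  let D := RSub (RLoad A (row_exp (iv x1) (iv 3))) (RLoad A (row_exp (iv x2) (iv 3))) in
  Seq (RStore 4 (ICst 0) (ROfI (ICst 0)))
    (for_cmd 3 dE (RStore 4 (ICst 0) (RAdd (rv 4) (RMul D D)))).

Definition update_cmd (b : bexp) : cmd :=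
  for_cmd 2 nE (Seq (dist_cmd 0 2 1)
    (If b (Seq (RStore 3 (iv 2) (rv 4)) (IStore 4 (iv 2) (iv 1))) Skip)).

Definition sample_cmd (A : nat) : cmd :=
  Seq (RStore 5 (ICst 0) (ROfI (ICst 0)))
 (Seq (IStore 1 (ICst 0) (ICst 0))
 (for_cmd 2 nE
   (Seq (RStore 5 (ICst 0) (RAdd (rv 5) (RLoad A (iv 2))))
   (Seq (Flip 5 (ICst 0) (RDiv (RLoad A (iv 2)) (rv 5)))
        (If (BLeI (ICst 1) (iv 5)) (IStore 1 (ICst 0) (iv 2)) Skip))))).

(** The first update has a test that always holds, so it assigns all points to the first anchor, the
    point 0 that the zero-initialized array 1 designates. *)
Definition seed_cmd : cmd :=
  Seq (update_cmd (BLeI (ICst 0) (ICst 0)))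
      (for_cmd 6 (IMul (ICst 8) kE)
        (Seq (sample_cmd 3) (update_cmd (BLeR (rv 4) (RLoad 3 (iv 2)))))).

Definition weights_cmd : cmd :=
  Seq (for_cmd 2 nE
        (Seq (RStore 6 (ICst 0) (RAdd (rv 6) (RLoad 3 (iv 2))))
             (IStore 7 (ILoad 4 (iv 2)) (IAdd (ILoad 7 (ILoad 4 (iv 2))) (ICst 1)))))
      (for_cmd 2 nE
        (RStore 7 (iv 2) (RAdd (RDiv (RLoad 3 (iv 2)) (rv 6))
           (RDiv (ROfI (ICst 1)) (ROfI (ILoad 7 (ILoad 4 (iv 2)))))))).

Definition add_row_cmd : cmd :=
  for_cmd 3 dE (RStore 9 (row_exp (iv 9) (iv 3)) (RAdd (RLoad 9 (row_exp (iv 9) (iv 3)))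
    (RDiv (RLoad 0 (row_exp (iv 1) (iv 3))) (RLoad 7 (iv 1))))).

(* The oracle answers negatively on equal points. *)
Definition slot_test : bexp :=
  orb_exp (BLeR (RLoad 8 (iv 9)) (ROfI (ICst 0)))
  (orb_exp (BAnd (BLeI (ILoad 11 (iv 9)) (iv 1)) (BLeI (iv 1) (ILoad 11 (iv 9))))
           (BLeI (ICst 1) (iv 12))).

(** The first slot that accepts takes the sample, and the flag in array 10 closes the remaining
    ones; thus a sample costs at most [k] queries. An empty slot accepts regardless of the
    answer. *)
Definition slot_cmd : cmd :=
  If (BLeI (iv 10) (ICst 0))
   (Seq (Query 12 (ICst 0) (ILoad 11 (iv 9)) (iv 1))
     (If slot_test
       (Seq (IStore 10 (ICst 0) (ICst 1))
       (Seq (IStore 11 (iv 9) (iv 1))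
       (Seq (RStore 8 (iv 9) (RAdd (RLoad 8 (iv 9)) (RDiv (ROfI (ICst 1)) (RLoad 7 (iv 1)))))
            add_row_cmd)))
       Skip))
   Skip.

Definition place_cmd : cmd :=
  Seq (IStore 10 (ICst 0) (ICst 0)) (for_cmd 9 kE slot_cmd).

Definition fill_cmd : cmd :=
  for_cmd 9 kE (for_cmd 3 dE (RStore 1 (row_exp (iv 9) (iv 3))
    (RDiv (RLoad 9 (row_exp (iv 9) (iv 3))) (RLoad 8 (iv 9))))).

(* A center that repeats an earlier one is moved away from the earlier ones:
   its first coordinate becomes 1 plus the squares of theirs. *)
Definition uniq_cmd : cmd :=
  for_cmd 9 kE
   (Seq (RStore 10 (ICst 0) (ROfI (ICst 1)))
   (Seq (IStore 14 (ICst 0) (ICst 0))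
   (Seq (for_cmd 13 (iv 9)
          (Seq (dist_cmd 1 9 13)
          (Seq (If (BLeR (rv 4) (ROfI (ICst 0))) (IStore 14 (ICst 0) (ICst 1)) Skip)
               (RStore 10 (ICst 0) (RAdd (rv 10)
                  (RMul (RLoad 1 (row_exp (iv 13) (ICst 0)))
                        (RLoad 1 (row_exp (iv 13) (ICst 0)))))))))
        (If (BLeI (ICst 1) (iv 14)) (RStore 1 (row_exp (iv 9) (ICst 0)) (rv 10)) Skip)))).

(** The loop stops at the first [i] with M k^3 <= i eps^3. The guard is evaluated directly in real
    arithmetic, so the number of samples is never computed. *)
Definition loop_cmd (M : nat) : cmd :=
  While (BNot (BLeR (RMul (ROfI (ICst M)) (ROfI (IMul kE (IMul kE kE))))
                    (RMul (ROfI (iv 8)) (RMul (rv 2) (RMul (rv 2) (rv 2))))))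
    (Seq (sample_cmd 7) (Seq place_cmd (IStore 8 (ICst 0) (IAdd (iv 8) (ICst 1))))).

Definition prog (M : nat) : cmd :=
  Seq seed_cmd (Seq weights_cmd (Seq (loop_cmd M) (Seq fill_cmd uniq_cmd))).

Lemma row_index_inj (d l l' j j' : nat) : (j < d)%N -> (j' < d)%N ->
  (l * d + j == l' * d + j')%N = (l == l') && (j == j').
Proof.
move=> hj hj'; apply/eqP/andP => [h|[/eqP -> /eqP -> //]].
have d0 : (0 < d)%N by apply: leq_ltn_trans hj.
have := congr1 (divn^~ d) h; rewrite /= !divnMDl // !divn_small // !addn0 => ->.
by have := congr1 (modn^~ d) h; rewrite /= !modnMDl !modn_small // => ->.
Qed.

(** * Correctness of the distance, update and sampling code *)

Section Programs.
Variables (R : realType) (orc : nat -> nat -> bool) (Q E : state R -> Prop).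
Variables (n d k : nat) (X : 'I_n -> 'rV[R]_d) (eps : R).
Implicit Types (s : state R) (v : R).

Local Notation exec := (exec orc Q E).
Local Notation pexec := (pexec orc Q E).

Lemma dist_spec A x1 x2 s : A != 4 -> x1 != 3 -> x2 != 3 -> imem s 0 1 = d ->
  exec (d * 4 + 5) (dist_cmd A x1 x2) s (fun s' => frame 0 [:: 3] [:: 4] s s' /\
    rmem s' 4 0 = \sum_(j < d) (rmem s A (imem s x1 0 * d + j)
                              - rmem s A (imem s x2 0 * d + j)) ^+ 2).
Proof.
move=> hA h1 h2 hd.
have -> : (d * 4 + 5 = (1 + (d * (1 + 3) + 3)).+1)%N by lia.
apply: exec_seq.
  by apply: (exec_rstore (P := fun s' => s' = set_real s 4 0 0)).
move=> _ ->.
pose F j := (rmem s A (imem s x1 0 * d + j) - rmem s A (imem s x2 0 * d + j)) ^+ 2.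
apply: (exec_for (Inv := fun i s' => frame 0 [:: 3] [:: 4] s s' /\
  rmem s' 4 0 = \sum_(j < i) F j)) => //.
- by move=> i s1 [[h _ _] _]; rewrite /= h.
- move=> i s1 hi ei [fr e4]; apply: exec_rstore; split=> //; split.
    by apply: frame_int => //; apply: frame_real.
  have [fi fr' _] := fr.
  rewrite /= updateE eqxx big_ord_recr /= e4 !fr' ?inE // ei (fi x1) ?inE // (fi x2) ?inE // (fi 0) // hd.
  by rewrite /F expr2.
split; last by rewrite /= big_ord0.
by apply: frame_int => //; apply: frame_real => //; apply: frame_refl.
Qed.

Definition input s : Prop :=
  [/\ imem s 0 0 = n, imem s 0 1 = d, imem s 0 2 = k,
      forall (x : 'I_n) (j : 'I_d), rmem s 0 (x * d + j) = X x 0 j & rmem s 2 0 = eps].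

Lemma input_frame q I J s s' : frame q I J s s' -> 0 \notin I -> 0 \notin J ->
  2 \notin J -> input s -> input s'.
Proof.
move=> [fi fr _] hI hJ hJ2 [h1 h2 h3 h4 h5].
by split=> [|||x j|]; rewrite ?fi ?fr.
Qed.

Lemma update_spec b (ch : 'I_n -> bool) (a : 'I_n) s : input s -> imem s 1 0 = a ->
  (forall (x : 'I_n) s1, frame 0 [:: 2; 3; 4] [:: 3; 4] s s1 -> imem s1 2 0 = x ->
     rmem s1 3 x = rmem s 3 x -> rmem s1 4 0 = sqdist (X x) (X a) -> beval s1 b = ch x) ->
  exec (n * (d * 4 + 13) + 3) (update_cmd b) s (fun s' =>
    frame 0 [:: 2; 3; 4] [:: 3; 4] s s' /\ forall x : 'I_n,
      imem s' 4 x = (if ch x then val a else imem s 4 x) /\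
      rmem s' 3 x = (if ch x then sqdist (X x) (X a) else rmem s 3 x)).
Proof.
move=> inp ea hb.
have -> : (n * (d * 4 + 13) + 3 = n * ((d * 4 + 5 + 4).+1 + 3) + 3)%N by lia.
pose Inv i s' := frame 0 [:: 2; 3; 4] [:: 3; 4] s s' /\ forall x : 'I_n,
      imem s' 4 x = (if (x < i)%N && ch x then val a else imem s 4 x) /\
      rmem s' 3 x = (if (x < i)%N && ch x then sqdist (X x) (X a) else rmem s 3 x).
apply: (exec_for (Inv := Inv)).
- by move=> i s1 [[h _ _] _]; rewrite /= h //; case: inp.
- move=> i s1 hi ei [fr hx]; pose x := Ordinal hi.
  have inp1 := input_frame fr isT isT isT inp.
  have [_ d1 _ X1 _] := inp1; have [fi1 _ _] := fr.
  apply: exec_seq; first exact: (dist_spec (A := 0) (x1 := 2) (x2 := 1) isT isT isT d1).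
  move=> s2 [fr2 e4]; have [fi2 fr2' _] := fr2.
  have fr02 : frame 0 [:: 2; 3; 4] [:: 3; 4] s s2.
    rewrite -[0%N]addn0; apply: frame_trans fr _; apply: frameW fr2 => //;
    by move=> y; rewrite !inE => /eqP ->.
  have e4' : rmem s2 4 0 = sqdist (X x) (X a).
    rewrite e4 ei fi1 // ea; apply: eq_bigr => j _.
    by rewrite -(X1 x j) -(X1 a j).
  have ei2 : imem s2 2 0 = i by rewrite fi2.
  have [_ h3] := hx x.
  have cb : beval s2 b = ch x.
    by apply: hb => //; rewrite fr2' // h3 ltnn.
  have case_eq (y : 'I_n) : (y < i.+1)%N = (y < i)%N || (y == x).
    by rewrite ltnS leq_eqVlt orbC.
  apply: exec_if; rewrite cb; case: (boolP (ch x)) => hc.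
    apply: (@exec_leq _ _ _ _ (1 + 1).+1); first lia.
    apply: exec_seq.
      by apply: (exec_rstore (P := fun s' => s' = set_real s2 3 i (sqdist (X x) (X a))));
        rewrite /= ei2 e4'.
    move=> _ ->; apply: exec_istore; rewrite /= ei2 fi2 // fi1 // ea; split=> //; split.
      by apply: frame_int => //; apply: frame_int => //; apply: frame_real.
    move=> y; rewrite /= /update /= case_eq -(inj_eq val_inj) /=.
    have [h5 h6] := hx y; have [eyi|nyi] := eqVneq (val y) i.
      have -> : y = x by apply: val_inj.
      by rewrite orbT hc.
    by rewrite orbF fi2 // fr2' // h5 h6.
  apply: (@exec_leq _ _ _ _ 1); first lia.
  apply: exec_skip; split=> //; split; first exact: frame_int.
  move=> y; rewrite /= /update /= case_eq -(inj_eq val_inj) /=.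
  have [h5 h6] := hx y; rewrite fi2 // fr2' // h5 h6.
  have [eyi|nyi] := eqVneq (val y) i; last by rewrite orbF.
  have -> : y = x by apply: val_inj.
  by rewrite (negbTE hc) !andbF.
- by split; [apply: frame_int => //; apply: frame_refl|].
- by move=> s' [fr h]; split=> // x; have := h x; rewrite ltn_ord.
Qed.

Definition anchors (b : 'I_n -> 'I_n) s := forall x : 'I_n,
  imem s 4 x = b x /\ rmem s 3 x = adist X b x.

Definition prefix_sum (w : 'I_n -> R) (i : nat) : R := \sum_(x : 'I_n | (x < i)%N) w x.

Lemma prefix_sumS (w : 'I_n -> R) (x : 'I_n) :
  prefix_sum w x.+1 = prefix_sum w x + w x.
Proof.
rewrite /prefix_sum (bigD1 x) //= addrC; congr (_ + _); apply: eq_bigl => y.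
by rewrite ltnS [RHS]ltn_neqAle andbC.
Qed.

Lemma prefix_sum_all (w : 'I_n -> R) : prefix_sum w n = \sum_x w x.
Proof. by apply: eq_bigl => x; rewrite ltn_ord. Qed.

Variable i0 : 'I_n.
Hypothesis i0E : val i0 = 0.

(* Reservoir sampling: the point seen last is kept with the probability that
   its weight represents among the weights seen so far. *)
Lemma sample_spec A (w G : 'I_n -> R) s (Post : state R -> R -> Prop) : A != 5 ->
  imem s 0 0 = n -> (forall x, 0 <= w x) -> (forall x : 'I_n, rmem s A x = w x) ->
  (forall s' (x : 'I_n), frame 0 [:: 1; 2; 5] [:: 5] s s' -> imem s' 1 0 = x ->
     Post s' (G x)) ->
  pexec (n * 9 + 7) (sample_cmd A) s (\sum_x sdist i0 w x * G x) Post.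
Proof.
move=> hA hn w0 hw hP; set v0 := \sum_x _.
have -> : (n * 9 + 7 = (1 + (1 + (n * (((1 + (1 + 2).+1)).+1 + 3) + 3)).+1).+1)%N by lia.
apply: pexec_seq.
  by apply: (pexec_rstore (Post := fun s' v' => s' = set_real s 5 0 0 /\ v' = v0)).
move=> _ _ [-> ->]; apply: pexec_seq.
  by apply: (pexec_istore (Post := fun s' v' =>
     s' = set_int (set_real s 5 0 0) 1 0 0 /\ v' = v0)).
move=> _ _ [-> ->].
pose S := \sum_x w x.
(* Expected final [G] after [i] points when [x] is held: the survival probabilities telescope, so
   [x] is kept with probability [prefix_sum w i / S] and each later [y] ends up selected with
   probability [w y / S]. If [S = 0], every coin has bias 0 and [x] stays. *)
pose val i (x : 'I_n) := if S == 0 then G x else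
  prefix_sum w i / S * G x + \sum_(y : 'I_n | (i <= y)%N) w y / S * G y.
pose Inv i s' v := [/\ frame 0 [:: 1; 2; 5] [:: 5] s s', rmem s' 5 0 = prefix_sum w i
  & exists2 x : 'I_n, imem s' 1 0 = x & v = val i x].
apply: (pexec_for (Inv := Inv)).
- by move=> i s1 v1 [[h _ _] _ _]; rewrite /= h.
- move=> i s1 v1 hi ei [fr e5 [x ex ->]].
  pose y := Ordinal hi.
  have p0 j : 0 <= prefix_sum w j by apply: sumr_ge0.
  have pS := prefix_sumS w y; have eA : rmem s1 A i = w y.
    by have [_ fr' _] := fr; rewrite fr' ?inE // -(hw y).
  pose s2 := set_real s1 5 0 (prefix_sum w i.+1).
  apply: pexec_seq.
    apply: (pexec_rstore (Post := fun s' v' => s' = s2 /\ v' = val i x)).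
    by rewrite /= ei e5 eA /s2 pS.
  move=> _ _ [-> ->].
  have fr2 : frame 0 [:: 1; 2; 5] [:: 5] s s2 by apply: frame_real.
  pose mid s' v := (s' = set_int s2 5 0 1 /\ v = val i.+1 y) \/
                   (s' = set_int s2 5 0 0 /\ v = val i.+1 x).
  apply: (pexec_seq (P1 := mid)).
    apply: (pexec_flip (v1 := val i.+1 y) (v2 := val i.+1 x)); [by left|by right|].
    rewrite /= ei /s2 /= /update eqxx (negbTE hA) /= eA.
    (* The bias already lies in [0, 1]; an empty prefix sum gives 0 / 0 = 0. *)
    have -> : clamp01 (w y / prefix_sum w i.+1) = w y / prefix_sum w i.+1.
      rewrite /clamp01 max_r ?divr_ge0 // min_r //.
      have [->|z] := eqVneq (prefix_sum w i.+1) 0; first by rewrite invr0 mulr0.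
      rewrite ler_pdivrMr ?mul1r ?pS ?lerDr //.
      by rewrite -pS lt_def z p0.
    rewrite /val; have [S0|S0] := eqVneq S 0.
      have -> : w y = 0.
        apply/eqP; rewrite eq_le w0 andbT -S0 /S (bigD1 y) //= lerDl.
        exact: sumr_ge0.
      by rewrite !mul0r add0r subr0 mul1r lexx.
    rewrite (bigD1 y) //= [X in _ + (_ + X)](_ : _ =
       \sum_(z : 'I_n | (i.+1 <= z)%N) w z / S * G z); last first.
      by apply: eq_bigl => z; rewrite [RHS]ltn_neqAle andbC eq_sym.
    set T := \sum_(z | _) _; rewrite -/(val y) pS.
    have [z|z] := eqVneq (prefix_sum w y + w y) 0.
      have := p0 y; have := w0 y => h1 h2.
      have -> : w y = 0 by lra.
      have -> : prefix_sum w i = 0 by rewrite -[i]/(nat_of_ord y); lra.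
      by rewrite !(mul0r, add0r, subr0, mul1r) lexx.
    rewrite le_eqVlt; apply/orP; left; apply/eqP; rewrite -[i]/(nat_of_ord y).
    by field; rewrite S0 z.
  move=> s' v' [] [-> ->]; apply: pexec_if => /=.
    apply: pexec_istore; rewrite /= /update /= ei; split=> //; split => /=.
    + by do 3!apply: frame_int => //.
    + by rewrite /update.
    + by exists y.
  apply: pexec_skip; split=> //; split => /=.
  + by do 2!apply: frame_int => //.
  + by rewrite /update.
  + by exists x => //=; rewrite ex.
- split.
  + by do 2!apply: frame_int => //; apply: frame_real => //; apply: frame_refl.
  + by rewrite /= /update /= /prefix_sum big_pred0.
  + exists i0; first by rewrite /= /update /= i0E.
    rewrite /v0 /val /sdist -/S; case: eqP => _.
      rewrite (bigD1 i0) //= eqxx mul1r big1 ?addr0 // => x /negbTE ->.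
      by rewrite mul0r.
    by rewrite /prefix_sum [X in X / S]big_pred0 // !mul0r add0r.
- move=> s' v [fr e5 [x ex ->]]; rewrite /val prefix_sum_all -/S.
  rewrite [X in _ + X]big_pred0 => [|y]; last by rewrite leqNgt ltn_ord.
  rewrite addr0; case: eqP => [_|/eqP S0]; first exact: hP.
  by rewrite divff // mul1r; apply: hP.
Qed.

End Programs.

(** * Correctness of the weights and of the seeding rounds *)

Section SeedWeights.
Variables (R : realType) (orc : nat -> nat -> bool) (Q E : state R -> Prop).
Variables (n d k : nat) (X : 'I_n -> 'rV[R]_d) (eps : R).
Implicit Types (s : state R) (v : R).

Local Notation exec := (exec orc Q E).
Local Notation pexec := (pexec orc Q E).
Local Notation input := (input k X eps).
Local Notation anchors := (anchors X).

Lemma weights_spec s b : input s -> anchors b s -> rmem s 6 0 = 0 ->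
  (forall p, imem s 7 p = 0) ->
  exec (n * 10 + 7) weights_cmd s (fun s' => frame 0 [:: 2; 7] [:: 6; 7] s s' /\
    forall x : 'I_n, rmem s' 7 x = aw X b x).
Proof.
move=> inp hb e6 e7; set I := [:: 2; 7]; set J := [:: 6; 7].
have en s' q : frame q I J s s' -> imem s' 0 0 = n.
  by case=> h _ _; rewrite h //; case: inp.
pose Inv i s' := [/\ frame 0 I J s s', rmem s' 6 0 = prefix_sum (adist X b) i &
  forall p : 'I_n, (imem s' 7 p)%:R = prefix_sum (fun x => (b x == p)%:R : R) i].
have -> : (n * 10 + 7 = (n * (1 + 1).+1.*2 + 3 + (n * (1 + 3) + 3)).+1)%N by lia.
apply: (exec_seq (P1 := Inv n)).
  have -> : (n * (1 + 1).+1.*2 = n * ((1 + 1).+1 + 3))%N by [].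
  apply: (exec_for (Inv := Inv)) => //.
  - by move=> i s1 [fr _ _]; apply: en fr.
  - move=> i s1 hi ei [fr h6 h7]; pose x := Ordinal hi.
    have [fi1 fr1 _] := fr.
    have [a4 a3] : imem s1 4 i = b x /\ rmem s1 3 i = adist X b x.
      by rewrite fi1 // fr1 //; apply: (hb x).
    apply: exec_seq.
      apply: (exec_rstore (P := fun s' => s' = set_real s1 6 0 (prefix_sum (adist X b) i.+1))).
      by rewrite /= ei a3 h6 (prefix_sumS _ x).
    move=> _ ->; apply: exec_istore; rewrite /= ei a4; split=> //; split.
    + by do 2!apply: frame_int => //; apply: frame_real.
    + by [].
    + move=> p; have := prefix_sumS (fun x => (b x == p)%:R : R) x.
      rewrite -[nat_of_ord x]/i => ->; rewrite -h7 /= /update /= [p == _ :> nat]eq_sym.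
      rewrite -(inj_eq val_inj) /= addn1; case: eqP => [->|_]; last by rewrite addr0.
      by rewrite natr1.
  - split.
    + by apply: frame_int => //; apply: frame_refl.
    + by rewrite /= e6 /prefix_sum big_pred0.
    + by move=> p; rewrite /= /update /= e7 /prefix_sum big_pred0.
move=> s1 [fr h6 h7]; rewrite !prefix_sum_all in h6.
have hc (p : 'I_n) : (imem s1 7 p)%:R = cell R b p.
  by rewrite h7 prefix_sum_all /cell [RHS]big_mkcond; apply: eq_bigr => x _; case: eqP.
pose Inv2 i s' := [/\ frame 0 I J s s', rmem s' 6 0 = acost X b,
  forall p : 'I_n, (imem s' 7 p)%:R = cell R b p &
  forall x : 'I_n, (x < i)%N -> rmem s' 7 x = aw X b x].
apply: (exec_for (Inv := Inv2)) => //.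
- by move=> i s2 [f2 _ _ _]; apply: en f2.
- move=> i s2 hi ei [f2 g6 g7 gw]; pose x := Ordinal hi.
  have [fi2 fr2 _] := f2.
  have [a4 a3] : imem s2 4 i = b x /\ rmem s2 3 i = adist X b x.
    by rewrite fi2 // fr2 //; apply: (hb x).
  apply: exec_rstore; rewrite /= ei a3 a4 g6 g7; split=> //; split=> //.
    by apply: frame_int => //; apply: frame_real.
  move=> y; rewrite /= /update /= ltnS leq_eqVlt; case: eqP => [ey _|_ /= /gw //].
  have -> : y = x by apply: val_inj.
  by rewrite /aw div1r.
- by split=> //; apply: frame_int.
- by move=> s2 [f2 _ _ gw]; split=> // x; apply: gw.
Qed.

Variable i0 : 'I_n.
Hypothesis i0E : val i0 = 0.

Lemma seed_spec s (v : ('I_n -> 'I_n) -> R) : input s -> imem s 1 0 = 0 ->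
  pexec (n * (d * 4 + 13) + 3 + (8 * k * (n * (d * 4 + 22) + 14) + 3)).+1
    seed_cmd s (iterV X i0 (8 * k) v (fun=> i0))
    (fun s' v' => exists b, [/\ v' = v b, anchors b s'
       & frame 0 [:: 1; 2; 3; 4; 5; 6] [:: 3; 4; 5] s s']).
Proof.
move=> inp e1; set I := [:: 1; 2; 3; 4; 5; 6]; set J := [:: 3; 4; 5].
have sub0 t t' : frame 0 [:: 2; 3; 4] [:: 3; 4] t t' -> frame 0 I J t t'.
  apply: frameW => // y; rewrite !inE; first by case/or3P => /eqP ->.
  by case/orP => /eqP ->.
pose Inv i s' v' := exists b, [/\ v' = iterV X i0 (8 * k - i) v b, anchors b s'
       & frame 0 I J s s'].
apply: (pexec_seq (P1 := Inv 0)).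
  apply: pexec_exec.
    by apply: (@update_spec R orc Q E n d k X eps _ xpredT i0) => //; rewrite e1 i0E.
  move=> s' [fr h]; exists (fun=> i0); split; rewrite ?subn0 //; last exact: sub0.
move=> s1 v1 hI0.
have -> : (8 * k * (n * (d * 4 + 22) + 14) =
  8 * k * ((n * 9 + 7 + (n * (d * 4 + 13) + 3)).+1 + 3))%N by lia.
apply: (pexec_for (Inv := Inv)).
- by move=> i s2 v2 [b [_ _ [h _ _]]]; rewrite /= h //; case: inp => _ _ ->.
- move=> i s2 v2 hi ei [b [-> hb fr]].
  have inp2 := input_frame fr isT isT isT inp; have [n2 _ _ _ _] := inp2.
  have -> : iterV X i0 (8 * k - i) v b = \sum_a sdist i0 (adist X b) a *
      iterV X i0 (8 * k - i.+1) v (upd X b a) by rewrite -(subnSK hi).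
  pose mid s' v' := exists2 a : 'I_n, v' = iterV X i0 (8 * k - i.+1) v (upd X b a) &
    frame 0 [:: 1; 2; 5] [:: 5] s2 s' /\ imem s' 1 0 = a.
  apply: (pexec_seq (P1 := mid)).
    apply: sample_spec => //.
    + by move=> x; apply: adist_ge0.
    + by move=> x; have [_ ->] := hb x.
    + by move=> s' a frs ea; exists a.
  move=> s3 _ [a -> [fr3 ea]]; have [fi3 fr3' _] := fr3.
  have fr03 : frame 0 I J s s3.
    rewrite -[0%N]addn0; apply: frame_trans fr _; apply: frameW fr3 => // y; rewrite !inE.
      by case/or3P => /eqP ->.
    by move=> /eqP ->.
  have hb3 : anchors b s3.
    by move=> x; have [<- <-] := hb x; rewrite fi3 // fr3'.
  apply: pexec_exec.
    apply: (@update_spec R orc Q E n d k X eps _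
      (fun x => sqdist (X x) (X a) <= adist X b x) a) => //.
      exact: input_frame fr03 isT isT isT inp.
    move=> x s4 fr4 e2 e3 e4 /=; rewrite e2 e3 e4.
    by have [_ ->] := hb3 x.
  move=> s4 [fr4 h4]; have [fi4 _ _] := fr4.
  split; first by rewrite fi4 // fi3.
  exists (upd X b a); split=> //.
    move=> x; rewrite /= /update /=; have [-> ->] := h4 x; have [-> ->] := hb3 x.
    by rewrite /update /= /adist /upd; case: ifP.
  apply: frame_int => //; rewrite -[0%N]addn0; apply: frame_trans fr03 _.
  exact: sub0.
- case: hI0 => b [-> hb fr]; exists b; split=> //.
  exact: frame_int.
- by move=> s2 v2 [b [-> hb fr]]; exists b; rewrite subnn.
Qed.

End SeedWeights.

(** * Classification of the samples by queries *)

Section Slots.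
Variables (R : realType) (Q E : state R -> Prop).
Variables (n d k : nat) (X : 'I_n -> 'rV[R]_d) (eps : R) (i0 : 'I_n).
Variables (f : 'I_n -> 'I_k) (w : 'I_n -> R).
Hypothesis w_gt0 : forall x, 0 < w x.
Implicit Types (s : state R) (v : R) (xs : seq 'I_n).

Local Notation exec := (exec (oracle f) Q E).
Local Notation input := (input k X eps).

Lemma add_row_spec s (a : 'I_n) l : input s -> imem s 9 0 = l -> imem s 1 0 = a ->
  rmem s 7 a = w a ->
  exec (d * 4 + 3) add_row_cmd s (fun s' => frame 0 [:: 3] [:: 9] s s' /\
    forall l' (j : 'I_d), rmem s' 9 (l' * d + j) =
      rmem s 9 (l' * d + j) + (if l' == l then X a 0 j / w a else 0)).
Proof.
move=> inp e9 e1 ew; have [_ dd _ hX _] := inp.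
pose Inv i s' := frame 0 [:: 3] [:: 9] s s' /\
    forall l' (j : 'I_d), rmem s' 9 (l' * d + j) =
      rmem s 9 (l' * d + j) + (if (l' == l) && (j < i)%N then X a 0 j / w a else 0).
apply: (exec_for (t := 1) (Inv := Inv)).
- by move=> i s1 [[h _ _] _]; rewrite /= h.
- move=> i s1 hi ei [fr h]; have [fi fr' _] := fr; pose y := Ordinal hi.
  apply: exec_rstore; rewrite /= ei !fi // e9 e1 dd (fr' 0) // (fr' 7) // (hX a y) ew; split=> //; split.
    by apply: frame_int => //; apply: frame_real.
  move=> l' j; rewrite /= updateE row_index_inj //.
  have [->|ne] := eqVneq l' l; last by rewrite /= h (negbTE ne).
  have [ej|nj] := eqVneq (val j) i.
    have -> : j = y by apply: val_inj.
    by rewrite /= (h l y) eqxx ltnn ltnSn /= addr0.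
  by rewrite /= h eqxx /= ltnS [in RHS]leq_eqVlt (negbTE nj).
- split; first by apply: frame_int => //; apply: frame_refl.
  by move=> l' j; rewrite ltn0 andbF addr0.
- by move=> s' [fr h]; split=> // l' j; rewrite h ltn_ord andbT.
Qed.

(** The program never sees labels. The ghost list [L] names the clusters met so far in the order in
    which they received a slot; the slots beyond it are still zero. *)
Definition slots xs s : Prop := exists L : seq 'I_k,
  [/\ uniq L, forall j, (j \in L) = has (fun x => f x == j) xs,
      forall l, (l < size L)%N ->
        exists2 r : 'I_n, imem s 11 l = r & f r = nth (f i0) L l,
      forall l, (l < k)%N -> rmem s 8 l = (if (l < size L)%N then
        \sum_(x <- xs | f x == nth (f i0) L l) (w x)^-1 else 0)
    & forall l (j : 'I_d), (l < k)%N -> rmem s 9 (l * d + j) = (if (l < size L)%N then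
        \sum_(x <- xs | f x == nth (f i0) L l) X x 0 j / w x else 0)].

Lemma oracle_ordE (x y : 'I_n) : oracle f x y = (x != y) && (f x == f y).
Proof. by rewrite /oracle !valK. Qed.

Lemma place_spec xs (a : 'I_n) s : input s -> imem s 1 0 = a ->
  rmem s 7 a = w a -> slots xs s ->
  exec (k * (d * 4 + 16) + 5) place_cmd s (fun s' =>
    frame k [:: 3; 9; 10; 11; 12] [:: 8; 9] s s' /\ slots (a :: xs) s').
Proof.
move=> inp e1 ew [L [uL hL h11 h8 h9]].
set I := [:: 3; 9; 10; 11; 12]; set J := [:: 8; 9].
have szL : (size L <= k)%N by have := max_card (mem L); rewrite (card_uniqP uL) card_ord.
(* The slot that will accept [a]. For a new cluster, [index] returns [size L], which is the first
   empty slot; it exists because [f a :: L] is then duplicate-free in ['I_k]. *)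
pose ls := index (f a) L.
have lsk : (ls < k)%N.
  rewrite /ls; have [inL|ninL] := boolP (f a \in L).
    by apply: leq_trans szL; rewrite index_mem.
  rewrite memNindex //; have /card_uniqP : uniq (f a :: L) by rewrite /= ninL.
  by move=> /= h; have := max_card (mem (f a :: L)); rewrite h card_ord.
pose Inv i s' := [/\ frame i I J s s', imem s' 10 0 = (ls < i)%N,
   forall l, imem s' 11 l = (if (ls < i)%N && (l == ls) then val a else imem s 11 l),
   forall l, rmem s' 8 l = rmem s 8 l + (if (ls < i)%N && (l == ls) then (w a)^-1 else 0) &
   forall l (j : 'I_d), rmem s' 9 (l * d + j) = rmem s 9 (l * d + j) +
      (if (ls < i)%N && (l == ls) then X a 0 j / w a else 0)].
have -> : (k * (d * 4 + 16) + 5 = (1 + (k * (d * 4 + 13 + 3) + 3)).+1)%N by lia.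
apply: exec_seq.
  by apply: (exec_istore (P := fun s' => s' = set_int s 10 0 0)).
move=> _ ->; apply: (exec_for (Inv := Inv)).
- by move=> i s1 [[h _ _] _ _ _ _]; rewrite /= h //; case: inp.
- move=> i s1 hi ei [fr g10 g11 g8 g9]; have [fi fr' fq] := fr.
  have -> : (d * 4 + 13 = (d * 4 + 12).+1)%N by lia.
  apply: exec_if; rewrite /= g10; have [hls|hls] := ltnP ls i.
    apply: (@exec_leq _ _ _ _ 1); first lia.
    apply: exec_skip; split=> //.
    have hls' : (ls < i.+1)%N by apply: ltnW.
    split.
    + by apply: frame_int => //; apply: frameW fr => //; apply: leqnSn.
    + by rewrite /= /update /= g10 hls hls'.
    + by move=> l; rewrite /= /update /= g11 hls hls'.
    + by move=> l; rewrite /= g8 hls hls'.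
    + by move=> l j; rewrite /= g9 hls hls'.
  have nls : (ls < i)%N = false by rewrite ltnNge hls.
  rewrite /=; have -> : (d * 4 + 12 = (1 + (d * 4 + 9).+1).+1)%N by lia.
  pose s2 := set_int (add_query s1) 12 0 (oracle f (imem s 11 i) a).
  apply: exec_seq.
    apply: (exec_query (P := fun s' => s' = s2)).
    by rewrite /= ei g11 nls (fi 1) // e1.
  move=> _ ->.
  have fr2 : frame i.+1 I J s s2.
    apply: frame_int => //; split=> //=.
    by rewrite addnS ltnS.
  apply: exec_if.
  have -> : beval s2 slot_test = (i == ls).
    rewrite /= /update /= ei g8 g11 nls /= addr0 (fi 1) // e1.
    rewrite !negb_and !negbK -negb_and negbK -eqn_leq lt0b.
    have [lt|ge] := ltnP i (size L).
      have [r er fr_] := h11 _ lt; rewrite er oracle_ordE h8 // lt.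
      (* An occupied slot contains some sample and weights are positive, so its total weight never
         passes the emptiness test. *)
      have -> : (\sum_(x <- xs | f x == nth (f i0) L i) (w x)^-1 <= 0) = false.
        apply/negbTE; rewrite -ltNge.
        have : nth (f i0) L i \in L by rewrite mem_nth.
        rewrite hL => /hasP[x xxs fx].
        rewrite big_mkcond (big_rem x) //= fx ltr_pwDl ?invr_gt0 //.
        by apply: sumr_ge0 => z _; case: ifP => // _; rewrite invr_ge0 ltW.
      rewrite (inj_eq val_inj) /= fr_.
      have -> : (i == ls) = (nth (f i0) L i == f a).
        apply/eqP/eqP => [e|e]; last by rewrite /ls -e index_uniq.
        by rewrite e nth_index // -index_mem -/ls -e.
      have [era|] := eqVneq r a; last by case: (nth _ _ _ == _).
      by rewrite -fr_ era eqxx.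
    rewrite h8 // ltnNge ge /= lexx /=; apply/esym/eqP.
    have : (ls <= size L)%N by apply: index_size.
    lia.
  have [els|nels] := eqVneq i ls; last first.
    apply: (@exec_leq _ _ _ _ 1); first lia.
    have nls' : (ls < i.+1)%N = false by apply/negbTE; move: nels hls; lia.
    apply: exec_skip; split=> //; split.
    + exact: frame_int.
    + by rewrite /= /update /= g10 nls nls'.
    + by move=> l; rewrite /= /update /= g11 nls nls'.
    + by move=> l; rewrite /= g8 nls nls'.
    + by move=> l j; rewrite /= g9 nls nls'.
  apply: (@exec_leq _ _ _ _ (1 + (1 + (1 + (d * 4 + 3)).+1).+1).+1); first lia.
  pose s3 := set_int s2 10 0 1.
  apply: exec_seq; first exact: (exec_istore (P := fun s' => s' = s3)).
  (* The representative is replaced by the newest sample, which is of the same cluster if the slot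
     was occupied. *)
  move=> _ ->; pose s4 := set_int s3 11 i a.
  apply: exec_seq.
    apply: (exec_istore (P := fun s' => s' = s4)).
    by rewrite /= /update /= ei (fi 1) // e1.
  move=> _ ->; pose s5 := set_real s4 8 i (rmem s 8 i + (w a)^-1).
  have a7 : rmem s1 7 a = w a by rewrite fr'.
  apply: exec_seq.
    apply: (exec_rstore (P := fun s' => s' = s5)).
    by rewrite /= /update /= ei (fi 1) // e1 g8 nls /= addr0 a7 div1r.
  move=> _ ->.
  have fr5 : frame i.+1 I J s s5.
    by apply: frame_real => //; do 2!apply: frame_int => //.
  have inp5 := input_frame fr5 isT isT isT inp.
  have e51 : imem s5 1 0 = a by have [-> //] := fr5.
  apply: execW (leqnn _) _ (add_row_spec (l := i) inp5 _ e51 _) => //.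
  move=> s6 [fr6 h6]; have [fi6 fr6' _] := fr6.
  split; first by rewrite fi6.
  have ls1 : (ls < i.+1)%N by rewrite els.
  split.
  + apply: frame_int => //; rewrite -[i.+1]addn0; apply: frame_trans fr5 _.
    by apply: frameW fr6 => // y; rewrite !inE => /eqP ->.
  + by rewrite /= /update /= fi6 // ls1.
  + move=> l; rewrite /= /update /= fi6 //= /update /= ls1 /= -els g11 nls /=.
    by [].
  + move=> l; rewrite /= fr6' //= /update /= ls1 /= -els g8 nls /= addr0.
    by case: eqP => [->|_]; rewrite ?addr0.
  + by move=> l j; rewrite /= h6 /= /update /= g9 nls /= addr0 ls1 -els.
- split.
  + by do 2!apply: frame_int => //; apply: frame_refl.
  + by rewrite /= /update.
  + by move=> l; rewrite /= /update.
  + by move=> l; rewrite /= addr0.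
  + by move=> l j; rewrite /= addr0.
move=> s' [fr g10 g11 g8 g9]; split=> //; rewrite lsk in g10 g11 g8 g9.
pose L' := if f a \in L then L else rcons L (f a).
have lsL' : (ls < size L')%N.
  rewrite /L'; case: ifP => h; first by rewrite /ls index_mem.
  by rewrite size_rcons ltnS index_size.
have nthls : nth (f i0) L' ls = f a.
  rewrite /L' /ls; case: ifP => h; first by rewrite nth_index.
  by rewrite memNindex ?h // nth_rcons ltnn eqxx.
have nthlt l : (l < size L)%N -> nth (f i0) L' l = nth (f i0) L l.
  by move=> hl; rewrite /L'; case: ifP => h //; rewrite nth_rcons hl.
have uL' : uniq L' by rewrite /L'; case: ifP => h //; rewrite rcons_uniq h.
have ltL' l : (l < size L')%N = (l < size L)%N || (l == ls).
  rewrite /L' /ls; case: ifP => h; last first.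
    by rewrite size_rcons memNindex ?h // ltnS leq_eqVlt orbC.
  have : (index (f a) L < size L)%N by rewrite index_mem.
  by case: eqP => [-> ->|_ _]; rewrite ?orbT ?orbF.
have lsnew l : (l < size L)%N -> l != ls -> f a == nth (f i0) L l = false.
  move=> hl nl; apply/negP => /eqP fa; case/negP: nl; rewrite /ls fa index_uniq //.
have nhit : (size L <= ls)%N -> forall F : 'I_n -> R,
    \sum_(x <- xs | f x == f a) F x = 0.
  move=> hs F; rewrite big1_seq // => x /andP[/eqP fx xxs].
  have : f a \in L by rewrite hL; apply/hasP; exists x => //; rewrite fx.
  by rewrite -index_mem -/ls ltnNge hs.
exists L'; split=> //.
- move=> j; rewrite /= -hL /L'; case: ifP => h.
    by case: eqP => // <-.
  by rewrite mem_rcons inE eq_sym.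
- move=> l; rewrite ltL' g11 /=; have [-> _|nl] := eqVneq l ls.
    by exists a; rewrite ?nthls.
  by rewrite orbF => hl; rewrite nthlt //; apply: h11.
- move=> l hl; rewrite g8 h8 // ltL' big_cons /=; have [->|nl] := eqVneq l ls.
    rewrite orbT nthls eqxx addrC; have [//|hs] := ltnP ls (size L).
      by move=> hs; rewrite -(nthlt _ hs) nthls.
    by rewrite nhit.
  by rewrite orbF addr0; case: ifP => // hs; rewrite nthlt // lsnew.
- move=> l j hl; rewrite g9 h9 // ltL' big_cons /=; have [->|nl] := eqVneq l ls.
    rewrite orbT nthls eqxx addrC; have [//|hs] := ltnP ls (size L).
      by move=> hs; rewrite -(nthlt _ hs) nthls.
    by rewrite nhit.
  by rewrite orbF addr0; case: ifP => // hs; rewrite nthlt // lsnew.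
Qed.

End Slots.

(** * Writing the centers and making them distinct *)

Section Output.
Variables (R : realType) (orc : nat -> nat -> bool) (Q E : state R -> Prop).
Variables (d k : nat).
Hypothesis d_gt0 : (0 < d)%N.
Implicit Types (s : state R) (v : R).

Local Notation exec := (exec orc Q E).

Lemma fill_spec s : imem s 0 1 = d -> imem s 0 2 = k ->
  exec (k * (d * 4 + 6) + 3) fill_cmd s (fun s' => frame 0 [:: 3; 9] [:: 1] s s' /\
    forall l (j : 'I_d), (l < k)%N ->
      rmem s' 1 (l * d + j) = rmem s 9 (l * d + j) / rmem s 8 l).
Proof.
move=> hd hk.
pose Inv i s' := frame 0 [:: 3; 9] [:: 1] s s' /\ forall l (j : 'I_d), (l < i)%N ->
      rmem s' 1 (l * d + j) = rmem s 9 (l * d + j) / rmem s 8 l.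
have -> : (k * (d * 4 + 6) = k * (d * (1 + 3) + 3 + 3))%N by lia.
apply: (exec_for (Inv := Inv)) => //.
- by move=> i s1 [[h _ _] _]; rewrite /= h.
- move=> i s1 hi ei [fr h].
  pose Inv2 m s' := [/\ frame 0 [:: 3; 9] [:: 1] s s', imem s' 9 0 = i &
    forall l (j : 'I_d), (l < i)%N || (l == i) && (j < m)%N ->
      rmem s' 1 (l * d + j) = rmem s 9 (l * d + j) / rmem s 8 l].
  apply: (exec_for (Inv := Inv2)).
  + by move=> m s2 [[h2 _ _] _ _]; rewrite /= h2.
  + move=> m s2 hm em [fr2 e9 h2]; have [fi2 fr2' _] := fr2.
    apply: exec_rstore; rewrite /= em e9 (fi2 0) // hd !fr2' //; split=> //; split=> //.
      by apply: frame_int => //; apply: frame_real.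
    move=> l j; rewrite /= updateE row_index_inj // ltnS (leq_eqVlt j).
    have [->|nl] := eqVneq l i; last by rewrite /= orbF => hl; apply: h2; rewrite hl.
    rewrite ltnn /=; have [->|nj] := eqVneq (nat_of_ord j) m => //= hj.
    by apply: h2; rewrite eqxx hj orbT.
  + split=> //; first exact: frame_int.
    by move=> l j; rewrite ltn0 andbF orbF; apply: h.
  + move=> s2 [fr2 e9 h2]; split=> //; split; first exact: frame_int.
    move=> l j hl; apply: h2; rewrite ltn_ord andbT orbC -leq_eqVlt; exact: hl.
- by split=> //; apply: frame_int => //; apply: frame_refl.
Qed.

Definition out_row s (l : nat) : 'rV[R]_d := \row_(j < d) rmem s 1 (l * d + j).

(** Only repeated rows are overwritten, so every row survives somewhere. This suffices because
    additional centers never raise the cost. *)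
Lemma uniq_spec s : imem s 0 1 = d -> imem s 0 2 = k ->
  exec (k * (k * (d * 4 + 14) + 14) + 3) uniq_cmd s (fun s' =>
    [/\ frame 0 [:: 3; 9; 13; 14] [:: 1; 4; 10] s s',
        uniq [seq out_row s' l | l : 'I_k] &
        forall l, (l < k)%N -> out_row s l \in [seq out_row s' l | l : 'I_k]]).
Proof.
move=> hd hk; set I := [:: 3; 9; 13; 14]; set J := [:: 1; 4; 10].
pose Inv i s' := [/\ frame 0 I J s s',
  forall l, (i <= l)%N -> out_row s' l = out_row s l,
  forall l l', (l < l')%N -> (l' < i)%N -> out_row s' l != out_row s' l' &
  forall l, (l < i)%N -> exists2 l', (l' < i)%N & out_row s l = out_row s' l'].
pose z : 'I_d := Ordinal d_gt0.
have -> : (k * (d * 4 + 14) + 14 = k * (d * 4 + 14) + 11 + 3)%N by lia.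
apply: (exec_for (Inv := Inv)).
- by move=> i s1 [[h _ _] _ _ _]; rewrite /= h.
- move=> i s1 hi ei [fr h1 h2 h3]; have [fi1 fr1 _] := fr.
  have d1 : imem s1 0 1 = d by rewrite fi1.
  apply: (@exec_leq _ _ _ _ (1 + (1 + ((i * ((d * 4 + 5 + (2 + 1).+1).+1 + 3) + 3) + 2).+1).+1).+1).
    have : (i * (d * 4 + 13) <= k * (d * 4 + 13))%N by rewrite leq_mul2r ltnW ?orbT.
    lia.
  pose s2 := set_int (set_real s1 10 0 1) 14 0 0.
  apply: exec_seq; first exact: (exec_rstore (P := fun s' => s' = set_real s1 10 0 1)).
  move=> _ ->; apply: exec_seq; first exact: (exec_istore (P := fun s' => s' = s2)).
  move=> _ ->.
  have fr2 : frame 0 I J s s2 by apply: frame_int => //; apply: frame_real.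
  pose Inv2 m s' := [/\ frame 0 I J s s', imem s' 9 0 = i,
    forall x, rmem s' 1 x = rmem s1 1 x,
    (0 < imem s' 14 0)%N = [exists l : 'I_m, out_row s1 l == out_row s1 i] &
    forall l, (l < m)%N -> rmem s1 1 (l * d) < rmem s' 10 0 /\ 1 <= rmem s' 10 0].
  apply: (exec_seq (P1 := fun s' => Inv2 i s')).
    apply: (exec_for (Inv := fun m s' => Inv2 m s' /\ 1 <= rmem s' 10 0)).
    + by move=> m s3 [[_ e9 _ _ _] _]; rewrite /= e9.
    + move=> m s3 hm em [[fr3 e9 r3 e14 b3] b10]; have [fi3 _ _] := fr3.
      have d3 : imem s3 0 1 = d by rewrite fi3.
      apply: exec_seq; first exact: (dist_spec (A := 1) (x1 := 9) (x2 := 13)).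
      move=> s4 [fr4 e4]; have [fi4 fr4' _] := fr4.
      have e4' : rmem s4 4 0 = sqdist (out_row s1 i) (out_row s1 m).
        rewrite e4 e9 em; apply: eq_bigr => j _; rewrite !mxE !r3 //.
      have t4 : (rmem s4 4 0 <= 0) = (out_row s1 m == out_row s1 i).
        rewrite e4'; apply/idP/eqP => [h|->]; last by rewrite sqdistxx.
        by apply/esym/sqdist_eq0/eqP; rewrite eq_le h sqdist_ge0.
      have fr04 : frame 0 I J s s4.
        rewrite -[0%N]addn0; apply: frame_trans fr3 _.
        by apply: frameW fr4 => // y; rewrite !inE => /eqP ->.
      pose dup := (0 < imem s3 14 0)%N || (out_row s1 m == out_row s1 i).
      apply: (exec_seq (P1 := fun s' => [/\ frame 0 I J s s', imem s' 9 0 = i,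
         forall x, rmem s' 1 x = rmem s1 1 x, (0 < imem s' 14 0)%N = dup &
         rmem s' 10 0 = rmem s3 10 0 /\ imem s' 13 0 = m])).
        apply: exec_if; rewrite /= t4 /dup; case: (out_row s1 m == out_row s1 i).
          apply: exec_istore; rewrite orbT; split=> //=.
          * exact: frame_int.
          * by rewrite /update /= fi4.
          * by move=> x; rewrite fr4' // r3.
          * by rewrite /update /= fr4' // fi4.
        apply: exec_skip; rewrite orbF; split=> //; rewrite ?fi4 ?fr4' //.
        by move=> x; rewrite fr4' // r3.
      move=> s5 [fr5 g9 r5 g14 [g10 g13]]; have [fi5 _ _] := fr5.
      apply: exec_rstore; rewrite /= g13 fi5 // hd addn0 g10 r5.
      have sq0 := sqr_ge0 (rmem s1 1 (m * d)); rewrite expr2 in sq0.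
      split=> //; split; last by rewrite /= /update /=; lra.
      split=> //=.
      * by apply: frame_int => //; apply: frame_real.
      * rewrite /update /= g14 /dup e14; apply/orP/existsP.
          case=> [/existsP[l hl]|hl]; last by exists ord_max.
          by exists (widen_ord (leqnSn m) l).
        case=> l hl; have [em'|lm] := eqVneq (nat_of_ord l) m.
          by right; rewrite -em'.
        have lm' : (l < m)%N by rewrite ltn_neqAle lm -ltnS ltn_ord.
        by left; apply/existsP; exists (Ordinal lm').
      (* The accumulator starts at 1 and gains y^2, and 1 + y^2 > y: it strictly exceeds the first
         coordinate of every earlier row. *)
      * move=> l; rewrite /update /= ltnS leq_eqVlt => /orP[/eqP ->|/b3[h _]]; last lra.
        set y := rmem s1 1 (m * d) in sq0 *.
        have := sqr_ge0 (y - 1); have := sqr_ge0 y; rewrite !expr2; nra.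
    + split; last by rewrite /= /update.
      split=> //.
      * exact: frame_int.
      * by rewrite /= /update /=; apply/esym/existsP => -[[]].
    + by move=> s3 [].
  move=> s3 [fr3 e9 r3 e14 b3]; have [fi3 _ _] := fr3.
  have rowS m s' : (forall x, rmem s' 1 x = rmem s1 1 x) -> out_row s' m = out_row s1 m.
    by move=> hr; apply/rowP => j; rewrite !mxE hr.
  apply: exec_if; rewrite /= e14; case: (boolP [exists l : 'I_i, out_row s1 l == out_row s1 i]).
    (* Row [i] repeats row [l0], which keeps its value. The new row differs from all earlier ones in
       coordinate 0, which exists as [d > 0]. *)
    move=> /existsP[l0 /eqP hl0]; apply: exec_rstore; rewrite /= e9 fi3 // hd addn0.
    split=> //; set s4 := set_int _ _ _ _.
    have [_ bb] := b3 _ (ltn_ord l0).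
    have r4 l : l != i -> out_row s4 l = out_row s1 l.
      move=> nl; apply/rowP => j; rewrite !mxE /= updateE r3.
      by rewrite -[X in _ == X](addn0) row_index_inj // (negbTE nl).
    have r4i : out_row s4 i 0 z = rmem s3 10 0.
      by rewrite mxE /= updateE addn0 eqxx.
    split.
    + by apply: frame_int => //; apply: frame_real.
    + move=> l hl; rewrite r4; last by rewrite gtn_eqF.
      by apply: h1; apply: ltnW.
    + move=> l l' hll; rewrite ltnS leq_eqVlt => /orP[/eqP el'|hl'].
        subst l'; rewrite r4; last by rewrite ltn_eqF.
        apply/eqP => /(congr1 (fun r : 'rV[R]_d => r 0 z)); rewrite r4i mxE /= addn0.
        by move=> h; have [] := b3 _ hll; rewrite h ltxx.
      rewrite !r4; [exact: h2| |]; rewrite ltn_eqF //; exact: ltn_trans hl'.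
    + move=> l; rewrite ltnS leq_eqVlt => /orP[/eqP ->|/h3[l' hl' ->]].
        exists l0; first by apply: ltnW; rewrite ltnS ltn_ord.
        by rewrite r4 ?ltn_eqF // hl0 h1.
      by exists l'; [apply: ltnW|rewrite r4 // ltn_eqF].
  move=> nex; apply: exec_skip; split=> //; set s4 := set_int _ _ _ _.
  have r4 l : out_row s4 l = out_row s1 l by apply: rowS.
  split.
  + exact: frame_int.
  + by move=> l hl; rewrite r4; apply: h1; apply: ltnW.
  + move=> l l' hll; rewrite ltnS leq_eqVlt !r4 => /orP[/eqP el'|hl']; last exact: h2.
    subst l'; apply: contra nex => h; apply/existsP; by exists (Ordinal hll).
  + move=> l; rewrite ltnS leq_eqVlt => /orP[/eqP ->|/h3[l' hl' ->]].
      by exists i => //; rewrite r4 h1.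
    by exists l'; [apply: ltnW|rewrite r4].
- split=> //; apply: frame_int => //; exact: frame_refl.
- move=> s' [fr h1 h2 h3]; split=> //.
    rewrite map_inj_uniq ?enum_uniq // => l l' e; apply: val_inj; apply/eqP.
    case: (ltngtP l l') => // hll; [have := h2 _ _ hll (ltn_ord l')|have := h2 _ _ hll (ltn_ord l)];
      by rewrite e eqxx.
  by move=> l /h3[l' hl' ->]; apply/mapP; exists (Ordinal hl'); rewrite ?mem_enum.
Qed.

End Output.

(** * The sampling loop *)

Section Loop.
Variables (R : realType) (Q E : state R -> Prop).
Variables (n d k : nat) (X : 'I_n -> 'rV[R]_d) (eps : R) (i0 : 'I_n).
Variables (f : 'I_n -> 'I_k) (w : 'I_n -> R) (M m : nat).
Hypothesis i0E : val i0 = 0.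
Hypothesis w_gt0 : forall x, 0 < w x.
Hypothesis mP : forall i : nat,
  (M%:R * (k * (k * k))%:R <= i%:R * (eps * (eps * eps))) = (m <= i)%N.
Implicit Types (s : state R) (v : R) (xs : seq 'I_n).

Local Notation input := (input k X eps).
Local Notation slots := (slots X i0 f w).

Lemma loop_spec s (h : seq 'I_n -> R) : input s ->
  (forall x : 'I_n, rmem s 7 x = w x) -> slots [::] s -> imem s 8 0 = 0 ->
  pexec (oracle f) Q E (m * (n * 9 + k * (d * 4 + 16) + 16)).+1 (loop_cmd M) s
    (iterE (sdist i0 w) m h [::])
    (fun s' v' => exists xs, [/\ size xs = m, v' = h xs, slots xs s'
      & frame (m * k) [:: 1; 2; 3; 5; 8; 9; 10; 11; 12] [:: 5; 8; 9] s s']).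
Proof.
move=> inp h7 hs h8; set I := [:: 1; 2; 3; 5; 8; 9; 10; 11; 12]; set J := [:: 5; 8; 9].
pose Inv t s' v' := exists xs, [/\ (size xs + t = m)%N, imem s' 8 0 = size xs,
  v' = iterE (sdist i0 w) t h xs, slots xs s' & frame (size xs * k) I J s s'].
have -> : (n * 9 + k * (d * 4 + 16) + 16 =
  ((n * 9 + 7 + (k * (d * 4 + 16) + 5 + 1).+1).+1).+1)%N by lia.
apply: (pexec_while (Inv := Inv)); last first.
  by exists [::]; split=> //; apply: frame_refl.
move=> t s1 v1 [xs [sz e8 -> hsl fr]].
have [fi1 fr1 _] := fr; have inp1 := input_frame fr isT isT isT inp.
have [n1 _ k1 _ ep1] := inp1.
rewrite /= e8 k1 ep1 mP -ltnNge; case: ltnP => hm; last first.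
  by exists xs; have t0 : t = 0 by [lia]; subst t; rewrite addn0 in sz; split; rewrite -?sz.
have [t' et] : exists t', t = t'.+1 by exists t.-1; lia.
subst t; exists t' => //.
pose mid s' v' := exists2 a : 'I_n, v' = iterE (sdist i0 w) t' h (a :: xs) &
    frame 0 [:: 1; 2; 5] [:: 5] s1 s' /\ imem s' 1 0 = a.
apply: (pexec_seq (P1 := mid)).
  apply: sample_spec => //.
  - by move=> x; rewrite ltW.
  - by move=> x; rewrite fr1.
  - by move=> s' a frs ea; exists a.
move=> s2 _ [a -> [fr2 ea]]; have [fi2 fr2' _] := fr2.
have inp2 := input_frame fr2 isT isT isT inp1.
have hsl2 : slots xs s2.
  have [L [p1 p2 p3 p4 p5]] := hsl; exists L; split=> //.
  - by move=> l; rewrite fi2 //; apply: p3.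
  - by move=> l; rewrite fr2' //; apply: p4.
  - by move=> l j; rewrite fr2' //; apply: p5.
pose mid2 s' v' := v' = iterE (sdist i0 w) t' h (a :: xs) /\
  (frame k [:: 3; 9; 10; 11; 12] [:: 8; 9] s2 s' /\ slots (a :: xs) s').
apply: (pexec_seq (P1 := mid2)).
  apply: pexec_exec; last by move=> s3 h3; split; [|exact: h3].
  by apply: place_spec inp2 ea _ hsl2 => //; rewrite fr2' // fr1.
move=> s3 _ [-> [fr3 hsl3]]; have [fi3 _ _] := fr3.
apply: pexec_istore; exists (a :: xs); rewrite /= fi3 // fi2 // e8 addn1; split=> //.
- by rewrite -sz addnS.
- apply: frame_int => //; rewrite mulSn addnC -[X in frame (_ + X)]add0n.
  apply: frame_trans fr _; apply: frame_trans.
    apply: frameW fr2 => // y; rewrite !inE; first by case/or3P => /eqP ->.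
    by move=> /eqP ->.
  apply: frameW fr3 => // y; rewrite !inE.
    by move=> /or4P[|||/orP[]] /eqP ->.
  by case/orP => /eqP ->.
Qed.

End Loop.

Lemma nth_flatten_rect (T : Type) (x0 : T) (ss : seq (seq T)) d i j :
  all (fun s => size s == d) ss -> (j < d)%N -> (i < size ss)%N ->
  nth x0 (flatten ss) (i * d + j) = nth x0 (nth [::] ss i) j.
Proof.
move=> + hj; elim: ss i => // s ss IH [|i] /= /andP[/eqP sz hall] hi.
  by rewrite mul0n add0n nth_cat sz hj.
rewrite nth_cat sz mulSn -addnA ltnNge leq_addr /= addKn; exact: IH.
Qed.

Lemma input_init (R : realType) n d k (eps : R) (X : 'I_n -> 'rV[R]_d) :
  input k X eps (init_state k eps X).
Proof.
split=> //= x j; rewrite nth_flatten_rect //.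
- by rewrite (nth_map x) ?size_enum_ord // (nth_map j) ?size_enum_ord // !nth_ord_enum.
- by apply/allP => _ /mapP[p _ ->]; rewrite size_map size_enum_ord.
- by rewrite size_map size_enum_ord.
Qed.

(** * Success probability of the whole program *)

Section Main.
Variables (R : realType) (n d k : nat) (X : 'I_n -> 'rV[R]_d) (eps : R) (i0 : 'I_n).
Variables (f : 'I_n -> 'I_k) (c : 'I_k -> 'rV[R]_d) (M m : nat).
Variables (Q : state R -> Prop).
Hypothesis i0E : val i0 = 0.
Hypothesis d_gt0 : (0 < d)%N.
Hypothesis k_gt0 : (0 < k)%N.
Hypothesis eps_bnd : 0 < eps <= 2^-1.
Hypothesis voronoi : forall i l, sqdist (X i) (c (f i)) <= sqdist (X i) (c l).
Hypothesis M_ge : 300 * 300 * 400 <= M%:R :> R.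
Hypothesis mP : forall i : nat,
  (M%:R * (k * (k * k))%:R <= i%:R * (eps * (eps * eps))) = (m <= i)%N.

(** Quantifying over all [C] that contain the weighted means leaves room for the other output
    centers, those of empty slots and the displaced duplicates. *)
Definition good (b : 'I_n -> 'I_n) (xs : seq 'I_n) : Prop := forall C : seq 'rV[R]_d,
  C != [::] -> (forall j, has (fun x => f x == j) xs -> wmean X f b xs j \in C) ->
  Phi C X <= (1 + eps) * cost X f c.

Definition success (s : state R) : Prop :=
  let C := output d k s in
  [/\ uniq C, size C = k & Phi C X <= (1 + eps) * cost X f c].

Lemma recovery_half (b : 'I_n -> 'I_n) : few (8 * k).+1 b ->
  acost X b <= 64 * cost X f c ->
  2^-1 <= iterE (sdist i0 (aw X b)) m (fun xs => `[< good b xs >]%:R) [::].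
Proof.
move=> [cs [szcs hcs]] ha; have /andP[e0 e1] := eps_bnd.
have k0 : 0 < k%:R :> R by rewrite ltr0n.
have k1 : 1 <= k%:R :> R by rewrite ler1n.
have -> : sdist i0 (aw X b) = aq X b.
  by apply/funext => x; rewrite /sdist /aq -/(awS X b) gt_eqF // awS_gt0.
pose z := eps ^+ 2 / (300 * 300 * k%:R).
have z0 : 0 < z by rewrite divr_gt0 ?exprn_gt0 // !mulr_gt0.
have zE : 300 * 300 * k%:R * z = eps ^+ 2.
  by rewrite /z mulrC divfK // gt_eqF // !mulr_gt0.
(* There are at most 8k + 1 anchors, so [awS <= 8k + 2 <= 10k]. *)
pose zeta := z / (10 * k%:R).
have zeta0 : 0 < zeta by rewrite divr_gt0 // mulr_gt0.
have zetaE : zeta * (10 * k%:R) = z by rewrite /zeta divfK // gt_eqF // mulr_gt0.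
apply: (@recovery _ _ _ _ X f c b i0 eps z zeta) => //.
- by rewrite zE.
- rewrite -zetaE ler_pM2l //; apply: le_trans (awS_le X hcs) _.
  apply: le_trans (_ : (8 * k).+2%:R <= _); first by rewrite ler_nat.
  by rewrite -natr1 -natr1 natrM; lra.
(* By the choice of [z] and [zeta], 40 k / (zeta eps) equals 300 * 300 * 400 * k^3 / eps^3, which is
   where the lower bound on [M] comes from. *)
- have hm : M%:R * (k * (k * k))%:R <= m%:R * (eps * (eps * eps)) by rewrite mP.
  have k2 : 0 < k%:R * k%:R :> R by rewrite mulr_gt0.
  have e3 : eps * (eps * eps) = 300 * 300 * 10 * (k%:R * k%:R) * (zeta * eps).
    have -> : 300 * 300 * 10 * (k%:R * k%:R) * (zeta * eps) =
       300 * 300 * k%:R * (zeta * (10 * k%:R)) * eps by ring.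
    by rewrite zetaE zE; ring.
  rewrite !natrM e3 in hm.
  have hM : 300 * 300 * 400 * (k%:R * (k%:R * k%:R)) <= M%:R * (k%:R * (k%:R * k%:R)) :> R.
    by rewrite ler_wpM2r // !mulr_ge0.
  have {hM} := le_trans hM hm.
  have -> : 300 * 300 * 400 * (k%:R * (k%:R * k%:R)) =
    300 * 300 * 10 * (k%:R * k%:R) * (40 * k%:R) :> R by ring.
  have -> : m%:R * (300 * 300 * 10 * (k%:R * k%:R) * (zeta * eps)) =
    300 * 300 * 10 * (k%:R * k%:R) * (m%:R * zeta * eps) by ring.
  by rewrite ler_pM2l // !mulr_gt0.
- by move=> xs _ hC; rewrite asboolT.
Qed.

Definition prog_time : nat :=
  ((n * (d * 4 + 13) + 3 + (8 * k * (n * (d * 4 + 22) + 14) + 3)).+1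
  + (n * 10 + 7 + ((m * (n * 9 + k * (d * 4 + 16) + 16)).+1
  + (k * (d * 4 + 6) + 3 + (k * (k * (d * 4 + 14) + 14) + 3)).+1).+1).+1).+1.

Lemma prog_achieves : (forall s, (nqueries s <= m * k)%N -> Q s) ->
  achieves (oracle f) Q success prog_time ([:: prog M], init_state k eps X) 4^-1.
Proof.
move=> hQ; set s0 := init_state k eps X; have inp := input_init k eps X.
pose v (b : 'I_n -> 'I_n) :=
  iterE (sdist i0 (aw X b)) m (fun xs => `[< good b xs >]%:R) [::] : R.
have v0 b : 0 <= v b.
  rewrite -[leLHS](iterE_cst (sdist_sum i0 (aw X b)) m 0 [::]).
  by apply: le_iterE => // a; apply: sdist_ge0 => x; rewrite ltW // aw_gt0.
apply: (@achievesW _ _ _ _ _ _ (iterV X i0 (8 * k) v (fun=> i0))) (leqnn _) _ _.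
  by apply: (seeding (c := c) i0 k_gt0 v0) => b; apply: recovery_half.
rewrite -[prog_time]addn0 /prog_time; set Post := fun (s : state R) (x : R) =>
  (nqueries s <= m * k)%N /\ x <= `[< success s >]%:R.
suff: pexec (oracle f) Q success prog_time (prog M) s0
    (iterV X i0 (8 * k) v (fun=> i0)) Post.
  move=> /(_ [::] 0%N); apply => s' v' [hq hv]; split=> /=; first exact: hQ.
  exact: hv.
rewrite /prog_time; pose P1 s' x := exists b, [/\ x = v b, anchors X b s'
  & frame 0 [:: 1; 2; 3; 4; 5; 6] [:: 3; 4; 5] s0 s'].
apply: (pexec_seq (P1 := P1)); first by apply: seed_spec inp _.
move=> s1 _ [b [-> hb fr1]]; have [fi1 fr1' nq1] := fr1.
have inp1 := input_frame fr1 isT isT isT inp.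
pose P2 s' x := x = v b /\ (frame 0 [:: 2; 7] [:: 6; 7] s1 s' /\
  forall x : 'I_n, rmem s' 7 x = aw X b x).
apply: (pexec_seq (P1 := P2)).
  apply: pexec_exec; last by move=> s' h'; split; [|exact: h'].
  have r6 : rmem s1 6 0 = 0 by rewrite fr1'.
  have i7 p : imem s1 7 p = 0 by rewrite fi1.
  exact: weights_spec inp1 hb r6 i7.
move=> s2 _ [-> [fr2 hw]]; have [fi2 fr2' nq2] := fr2.
have inp2 := input_frame fr2 isT isT isT inp1.
pose P3 (s' : state R) (x : R) := exists xs, [/\ size xs = m, x = `[< good b xs >]%:R,
  slots X i0 f (aw X b) xs s'
  & frame (m * k) [:: 1; 2; 3; 5; 8; 9; 10; 11; 12] [:: 5; 8; 9] s2 s'].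
apply: (pexec_seq (P1 := P3)).
  have sl : slots X i0 f (aw X b) [::] s2.
    exists [::]; split=> //; first by move=> l _; rewrite fr2' // fr1'.
    by move=> l j _; rewrite fr2' // fr1'.
  have i8 : imem s2 8 0 = 0 by rewrite fi2 // fi1.
  exact: (@loop_spec R Q success n d k X eps i0 f (aw X b) M m i0E (aw_gt0 X b) mP
    s2 _ inp2 hw sl i8).
move=> s3 _ [xs [sz -> hsl fr3]]; have [fi3 fr3' nq3] := fr3.
have inp3 := input_frame fr3 isT isT isT inp2; have [_ d3 k3 _ _] := inp3.
set g := _%:R; pose P4 (s' : state R) (x : R) := x = g /\ (frame 0 [:: 3; 9] [:: 1] s3 s' /\
    forall l (j : 'I_d), (l < k)%N ->
      rmem s' 1 (l * d + j) = rmem s3 9 (l * d + j) / rmem s3 8 l).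
apply: (pexec_seq (P1 := P4)).
  apply: pexec_exec; last by move=> s' h'; split; [|exact: h'].
  exact: fill_spec.
move=> s4 _ [-> [fr4 h4]]; have [fi4 _ nq4] := fr4.
apply: pexec_exec; first by apply: (uniq_spec (d := d) (k := k)); rewrite // fi4.
move=> s5 [[_ _ nq5] u5 hin]; split.
  by move: nq1 nq2 nq3 nq4 nq5; rewrite !addn0 /s0 /= => *; lia.
(* For a sample that is not good, the probability owed is 0. *)
rewrite /g; case: asboolP => hg; last by case: asboolP.
rewrite asboolT //; split=> //; first by rewrite size_map size_enum_ord.
apply: hg.
  by apply/eqP => /(congr1 size); rewrite size_map size_enum_ord /=; lia.
move=> j hj; have [L [uL hL _ p8 p9]] := hsl.
have jL : j \in L by rewrite hL.
have szL : (size L <= k)%N by have := max_card (mem L); rewrite (card_uniqP uL) card_ord.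
have iL : (index j L < size L)%N by rewrite index_mem.
have lk := leq_trans iL szL.
(* The slot of cluster [j] holds the two sums of [wmean], so its quotient is the required center. *)
have := hin _ lk; rewrite (_ : out_row d s4 _ = wmean X f b xs j) //.
apply/rowP => a; rewrite !mxE h4 // p8 // p9 // iL nth_index //.
Qed.

End Main.

(** * Running time and the final bounds *)

Lemma prog_time_le (n d k m : nat) : (0 < n)%N -> (0 < d)%N -> (0 < k)%N ->
  (prog_time n d k m <= 500 * (m + 1) * (n * d * k ^ 2))%N.
Proof.
move=> n0 d0 k0; rewrite /prog_time -mulnn; set N := (n * d * (k * k))%N.
have dk : (0 < d * (k * k))%N by rewrite !muln_gt0 d0 k0.
have h1 : (0 < N)%N by rewrite /N -mulnA muln_gt0 n0.
have h2 : (n <= N)%N by rewrite /N -mulnA leq_pmulr.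
have h3 : (n * d <= N)%N by rewrite /N leq_pmulr // muln_gt0 k0.
have h4 : (k * (n * d) <= N)%N by rewrite /N mulnC leq_mul // leq_pmulr.
have h5 : (k * n <= N)%N by apply: leq_trans h4; rewrite leq_mul // leq_pmulr.
have h6 : (k * d <= N)%N by apply: leq_trans h4; rewrite leq_mul // leq_pmull.
have h7 : (k <= N)%N by apply: leq_trans h5; rewrite leq_pmulr.
have h8 : (k * (k * d) <= N)%N.
  by rewrite /N -mulnA (mulnA k) (mulnC (k * k)) leq_pmull.
have h9 : (k * k <= N)%N by apply: leq_trans h8; rewrite leq_mul // leq_pmulr.
have m1 : (m * n <= m * N)%N by rewrite leq_mul.
have m2 : (m * (k * d) <= m * N)%N by rewrite leq_mul.
have m3 : (m * k <= m * N)%N by rewrite leq_mul.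
have m4 : (m <= m * N)%N by rewrite leq_pmulr.
clearbody N; lia.
Qed.

Theorem theorem7 (R : realType) :
  exists (P : cmd) (a : nat),
  forall (eps : R) (k n d : nat) (X : 'I_n -> 'rV[R]_d) (f : 'I_n -> 'I_k),
    0 < eps <= 2^-1 -> (0 < k)%N -> (0 < n)%N -> (0 < d)%N ->
    injective X -> optimal_clustering X f ->
    exists T : nat,
      [/\ T%:R <= a%:R * ((n * d * k ^ 9)%:R / eps ^+ 4),
          always (oracle f) T ([:: P], init_state k eps X)
            (fun s => (nqueries s)%:R <= a%:R * ((k ^ 9)%:R / eps ^+ 4))
        & 4^-1 <= Pr (oracle f) T ([:: P], init_state k eps X)
            (fun s => let C := output d k s in
               [/\ uniq C, size C = k &
                   Phi C X <= (1 + eps) * Delta k X])].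
Proof.
have [M M_ge] : exists M : nat, 300 * 300 * 400 <= M%:R :> R.
  by exists (300 * 300 * 400)%N; rewrite !natrM.
exists (prog M), (500 * (M + 2))%N => eps k n d X f eps_bnd k0 n0 d0 _ [c [_ cE voronoi]].
have costE := Phi_centers voronoi; rewrite cE in costE.
have /andP[e0 e1] := eps_bnd; pose e3 := eps * (eps * eps).
have e30 : 0 < e3 by rewrite !mulr_gt0.
pose B := M%:R * (k * (k * k))%:R : R.
have B0 : 0 <= B by rewrite mulr_ge0.
pose P (i : nat) := B <= i%:R * e3.
have exP : exists i, P i.
  exists (Num.bound (B / e3)); rewrite /P -ler_pdivrMr //.
  by apply/ltW/archi_boundP; rewrite divr_ge0 // ltW.
case: (ex_minnP exP) => m Pm min_m.
have mP i : (B <= i%:R * e3) = (m <= i)%N.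
  apply/idP/idP => [/min_m //|mi]; apply: le_trans Pm _.
  by rewrite ler_wpM2r ?ler_nat // ltW.
have k1 : 1 <= k%:R :> R by rewrite ler1n.
have e41 : 1 <= eps^-1 by rewrite invf_ge1 //; lra.
have e3E : e3^-1 = eps ^- 3 by rewrite /e3 !exprS expr0 mulr1.
have inv3 : 1 <= eps ^- 3 by rewrite -exprVn exprn_ege1.
(* Minimality of [m] gives [m <= B / e3 + 1]. The 2 in [M + 2] pays for this rounding and for the 1
   on the left, since [k^3 / eps^3 >= 1]. *)
have m_le : m%:R + 1 <= (M + 2)%:R * (k ^ 3)%:R * eps ^- 3 :> R.
  have hB : B / e3 = M%:R * (k ^ 3)%:R * eps ^- 3 by rewrite e3E.
  have hk3 : 1 <= (k ^ 3)%:R * eps ^- 3 :> R.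
    by rewrite -[leLHS]mulr1 ler_pM // ler1n expn_gt0 k0.
  suff : m%:R <= B / e3 + 1 by rewrite hB natrD; lra.
  case: m Pm min_m mP => [_ _ _|i _ _ hP]; first by rewrite addr_ge0 // divr_ge0 // ltW.
  rewrite -natr1 lerD2r ler_pdivlMr //; apply: ltW.
  by rewrite ltNge hP ltnn.
(* Weakened to the exponents of the statement: the time per sample supplies the two missing factors
   [k] of [k^9]. *)
have conv : m%:R + 1 <= (M + 2)%:R * (k ^ 7)%:R * eps ^- 4 :> R.
  apply: le_trans m_le _; rewrite -!mulrA ler_wpM2l // ler_pM //.
  - by rewrite ltW // (lt_le_trans ltr01).
  - by rewrite ler_nat leq_pexp2l.
  - by rewrite -!exprVn [leRHS]exprS ler_peMl // exprn_ge0 // invr_ge0 ltW.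
have k9 : (k ^ 9)%:R = (k ^ 7)%:R * k%:R * k%:R :> R by rewrite -!natrM -!expnSr.
have -> : Delta k X = cost X f c by rewrite -costE.
exists (prog_time n d k m).
have [] := @prog_achieves R n d k X eps (Ordinal n0) f c M m
  (fun s => (nqueries s)%:R <= (500 * (M + 2))%:R * ((k ^ 9)%:R / eps ^+ 4))
  erefl d0 k0 eps_bnd voronoi M_ge mP.
  move=> s hq; apply: le_trans (_ : (m * k)%:R <= _); first by rewrite ler_nat.
  rewrite natrM; apply: le_trans (_ : (M + 2)%:R * (k ^ 7)%:R * eps ^- 4 * k%:R <= _).
    by rewrite ler_wpM2r //; lra.
  set Y := _ * k%:R; have Y0 : 0 <= Y by rewrite !mulr_ge0 // invr_ge0 exprn_ge0 // ltW.
  have -> : (500 * (M + 2))%:R * ((k ^ 9)%:R / eps ^+ 4) = 500 * k%:R * Y.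
    by rewrite k9 natrM /Y; ring.
  by rewrite ler_peMl //; lra.
move=> h1 h2; split=> //.
apply: le_trans (_ : (500 * (m + 1) * (n * d * k ^ 2))%:R <= _).
  by rewrite ler_nat prog_time_le.
rewrite (natrM _ (500 * (m + 1)) (n * d * k ^ 2)) (natrM _ 500 (m + 1)).
rewrite (natrM _ (n * d) (k ^ 9)) (natrM _ 500 (M + 2)) k9 (natrD _ m 1).
have -> : (n * d * k ^ 2)%:R = (n * d)%:R * k%:R * k%:R :> R
  by rewrite -!natrM -(mulnA (n * d)) mulnn.
set W := (n * d)%:R; set A := (M + 2)%:R in conv *; set K := (k ^ 7)%:R in conv *.
have W0 : 0 <= 500 * (W * k%:R * k%:R) by rewrite !mulr_ge0.
have := ler_wpM2l W0 conv; lra.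
Qed.
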